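(* Let $\Gamma$ be a finitely generated non-abelian free group and let $\Gamma'<\Gamma$ be a subgroup of finite index. (1) If $\pi\in\mathbf{Mult}(\Gamma)$, then the restriction of $\pi$ to $\Gamma'$ belongs to $\mathbf{Mult}(\Gamma')$. (2) If $\pi\in\mathbf{Mult}(\Gamma')$, then the (unitary) induction $\operatorname{Ind}_{\Gamma'}^{\Gamma}(\pi)$ of $\pi$ to $\Gamma$ belongs to $\mathbf{Mult}(\Gamma)$.
   Context: The class $\mathbf{Mult}(\Gamma)$ is defined for any finitely generated non-abelian free group $\Gamma$ as follows (and the same definition applies to $\Gamma'$, which is again such a group). A finite symmetric set of free generators is $A=S\sqcup S^{-1}$ with $S$ a free basis of $\Gamma$. $a,b$ denote elements of $A$; $|x|$ is the length of the reduced word of $x\in\Gamma$ in the alphabet $A$; $E(a)$ is the set of $x$ whose reduced word ends with $a$. A matrix system $(V_a,H_{ba})$ consists of a finite dimensional complex vector space $V_a$ for each $a\in A$ and a linear map $H_{ba}:V_a\to V_b$ for each $a,b\in A$, with $H_{ba}=0$ whenever $ab=e$. A matrix system with inner products $(V_a,H_{ba},B_a)$ is a matrix system with a positive definite (Hermitian) sesquilinear form $B_a$ on each $V_a$ such that $B_a(v_a,v_a)=\sum_{b\in A}B_b(H_{ba}v_a,H_{ba}v_a)$ for all $a\in A$, $v_a\in V_a$. A multiplicative function is a function $f:\Gamma\to\coprod_{a\in A}V_a$ for which there is $N=N(f)\ge 0$ such that for every $x$ with $|x|\ge N$: $f(x)\in V_a$ if $x\in E(a)$, and $f(xb)=H_{ba}f(x)$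 if $x\in E(a)$ and $|xb|=|x|+1$. Two multiplicative functions are identified if they agree at all but finitely many points; $\mathcal H^\infty=\mathcal H^\infty(V_a,H_{ba})$ is the vector space of equivalence classes, with pointwise operations. For $f_1,f_2\in\mathcal H^\infty$ put $\langle f_1,f_2\rangle=\sum_{|x|=N}\sum_{a:\,|xa|=|x|+1}B_a(f_1(xa),f_2(xa))$ for $N$ large (independent of $N$). $\mathcal H(V_a,H_{ba},B_a)$ is the Hilbert space completion of $\mathcal H^\infty$, carrying the unitary representation $\pi$ of $\Gamma$ extending $(\pi(x)f)(y)=f(x^{-1}y)$. A unitary representation $(\rho,H)$ of $\Gamma$ belongs to $\mathbf{Mult}(\Gamma)$ if there exist a finite symmetric set $A$ of free generators of $\Gamma$, a matrix system with inner products $(V_a,H_{ba},B_a)$ indexed on $A$, a dense subspace $M\subseteq H$ and a unitary operator $U:H\to\mathcal H(V_a,H_{ba},B_a)$ such that $U$ restricts to an isomorphism of $M$ onto $\mathcal H^\infty(V_a,H_{ba})$ and $U(\rho(x)m)=\pi(x)(Um)$ for all $m\in M$, $x\in\Gamma$. For a unitary representation $(\pi',H')$ of $\Gamma'$, $\operatorname{Ind}_{\Gamma'}^{\Gamma}(\pi')$ acts on the space of functions $f:\Gamma\to H'$ with $\pi'(h)f(g)=f(gh^{-1})$ for $h\in\Gamma'$, $g\in\Gamma$, with norm $\|f\|^2=\sum\|f(g)\|^2$ over representatives $g$ of the cosets $g\Gamma'$, by $(\operatorname{Ind}_{\Gamma'}^{\Gamma}(\pi')(g_0)f)(g)=f(g_0^{-1}g)$.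 *)

(* Defs.v *)
(* The complex numbers are R[i], for an arbitrary R : realType. *)
From HB Require Import structures.
From mathcomp Require Import all_boot all_order all_algebra finmap complex.
From mathcomp Require Import boolp classical_sets functions cardinality fsbigop.
From mathcomp Require Import reals topology normedtype.

Set Implicit Arguments.
Unset Strict Implicit.
Unset Printing Implicit Defensive.

Import Order.TTheory GRing.Theory Num.Theory.
Import numFieldNormedType.Exports.

Local Open Scope classical_set_scope.
Local Open Scope ring_scope.
Local Open Scope quotient_scope.

Section FreeGroups.
Variable G : groupType.
Implicit Types (S : set G) (x : G) (w : seq G).

Definition symm_closure S : set G := S `|` [set x^-1%g | x in S].

Definition reduced_word S w : Prop :=
  (forall a, a \in w -> symm_closure S a) /\
  sorted (fun a b => a * b != 1)%g w.

(* The letters S and S^-1 are disjoint and every element has exactly one reduced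
   word. *)
Definition free_basis S : Prop :=
  S `&` [set x^-1%g | x in S] = set0 /\
  forall x, exists! w, reduced_word S w /\ (\prod_(a <- w) a)%g = x.

Definition free_group : Prop := exists S, free_basis S.

Definition finitely_generated_group : Prop :=
  exists X : {fset G}, forall x, exists w,
    (forall a, a \in w -> symm_closure [set` X] a) /\ (\prod_(a <- w) a)%g = x.

Definition abelian_group : Prop := forall x y, (x * y = y * x)%g.

(* The finite symmetric set of free generators is [letters] below; it is stored
   through the basis S.  A basis of a non-abelian free group is never empty, and
   nonemptiness is what provides a zero in the space of multiplicative
   functions. *)
Record free_generators := FreeGenerators {
  gens : {fset G};
  gens_free : free_basis [set` gens];
  gens_neq0 : gens != fset0 }.

Definition letters (A : free_generators) : {fset G} :=
  (gens A `|` [fset x^-1%g | x in gens A])%fset.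

Variable A : free_generators.

Definition rword x : seq G :=
  xget [::] [set w | reduced_word [set` gens A] w /\ (\prod_(a <- w) a)%g = x].

Definition wlen x : nat := size (rword x).

Definition endset (a : letters A) : set G :=
  [set x | exists w, rword x = rcons w (val a)].

Lemma lettersP (a : G) : a \in letters A <-> symm_closure [set` gens A] a.
Proof.
rewrite /letters in_fsetU; split.
  case/orP=> [|/imfsetP[x /= xS ->]]; first by left.
  by right; exists x.
case=> [/= ->//|[x /= xS <-]]; apply/orP; right.
by apply/imfsetP; exists x.
Qed.

Lemma rwordP x :
  reduced_word [set` gens A] (rword x) /\ (\prod_(a <- rword x) a)%g = x.
Proof.
case: (gens_free A) => _ /(_ x)[w [wx _]].
by rewrite /rword; case: xgetP => [y -> []//|/(_ w)].
Qed.

Lemma rword_uniq w : reduced_word [set` gens A] w ->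
  rword (\prod_(a <- w) a)%g = w.
Proof.
move=> rw; set x := (\prod_(a <- w) a)%g.
case: (gens_free A) => _ /(_ x)[w0 [_ w0u]].
by rewrite -(w0u (rword x) (rwordP x)); apply: w0u.
Qed.

Lemma reduced_cons w a b : reduced_word [set` gens A] (a :: b :: w) <->
  [/\ a \in letters A, (a * b != 1)%g & reduced_word [set` gens A] (b :: w)].
Proof.
split=> [[h /= /andP[ab s]]|[aA ab [h s]]].
  split=> //; first by apply/lettersP/h/mem_head.
  by split=> // c cw; apply: h; rewrite inE cw orbT.
by split=> [c|/=]; [rewrite inE => /predU1P[->|/h//]; apply/lettersP|rewrite ab].
Qed.

Lemma reduced_behead w a : reduced_word [set` gens A] (a :: w) ->
  reduced_word [set` gens A] w.
Proof.
move=> [h s]; split; first by move=> c cw; apply: h; rewrite inE cw orbT.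
by move: s => /= /path_sorted.
Qed.

Lemma reduced_rcons w a b : reduced_word [set` gens A] (rcons w a) ->
  b \in letters A -> (a * b != 1)%g ->
  reduced_word [set` gens A] (rcons (rcons w a) b).
Proof.
move=> [h s] bA ab; split.
  by move=> c; rewrite mem_rcons inE => /predU1P[->|/h//]; apply/lettersP.
by case: w s {h} => [|c w] /= s; rewrite ?ab// rcons_path last_rcons s.
Qed.

Lemma endset_inj a b x : endset a x -> endset b x -> a = b.
Proof.
by move=> [w e] [w2]; rewrite e => /rcons_inj[_ /val_inj].
Qed.

Lemma endset_ex x : (0 < wlen x)%N -> exists a, endset a x.
Proof.
rewrite /wlen => sx.
have [w [a e]] : exists w a, rword x = rcons w a.
  by move: sx; case: (lastP (rword x)) => // w a _; exists w, a.
have aA : a \in letters A.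
  by apply/lettersP; have [[h _] _] := rwordP x; apply: h; rewrite e mem_rcons mem_head.
by exists [` aA]%fset, w.
Qed.

Lemma endset_gt0 a x : endset a x -> (0 < wlen x)%N.
Proof. by rewrite /wlen => -[w ->]; rewrite size_rcons. Qed.

Lemma rword_mulr a (b : letters A) x : endset a x -> (val a * val b != 1)%g ->
  rword (x * val b)%g = rcons (rword x) (val b).
Proof.
move=> [w e] ab; have [rx px] := rwordP x.
have bA : val b \in letters A by exact: valP.
rewrite e in rx.
have := rword_uniq (reduced_rcons rx bA ab).
by rewrite -e -cats1 big_cat big_seq1 px.
Qed.

Lemma wlen_mulr_cancel a (b : letters A) x : endset a x -> (val a * val b = 1)%g ->
  (wlen (x * val b)%g).+1 = wlen x.
Proof.
move=> [w e] ab; have [rx px] := rwordP x.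
have rw : reduced_word [set` gens A] w.
  case: rx; rewrite e => h s; split.
    by move=> c cw; apply: h; rewrite mem_rcons inE cw orbT.
  by case: w s {e h} => //= c w; rewrite rcons_path => /andP[].
have -> : (x * val b)%g = (\prod_(a <- w) a)%g.
  by rewrite -px e -cats1 big_cat big_seq1 /= -mulgA ab mulg1.
by rewrite /wlen rword_uniq// e size_rcons.
Qed.

Lemma wlen_mulrP a (b : letters A) x : endset a x ->
  wlen (x * val b)%g = (wlen x).+1 <-> (val a * val b != 1)%g.
Proof.
move=> ax; split; last first.
  by move=> ab; rewrite /wlen (rword_mulr ax)// size_rcons.
move=> e; apply/eqP => ab; have := wlen_mulr_cancel ax ab.
by rewrite e => /eqP; rewrite -addn2 -{2}(addn0 (wlen x)) eqn_add2l.
Qed.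

Lemma endset_mulr a (b : letters A) x : endset a x ->
  wlen (x * val b)%g = (wlen x).+1 -> endset b (x * val b)%g.
Proof. by move=> ax /(wlen_mulrP b ax) ab; exists (rword x); exact: rword_mulr ab. Qed.

Lemma translate_letter (c : G) a y : c \in letters A -> (1 < wlen y)%N ->
  endset a y -> endset a (c * y)%g /\ (wlen y <= (wlen (c * y)%g).+1)%N.
Proof.
move=> cA y1 [w e]; have [ry py] := rwordP y; rewrite /wlen in y1 *.
case: w e => [|d w] e; first by rewrite e in y1.
rewrite rcons_cons in e; rewrite e in y1 ry py.
rewrite big_cons in py.
have [cd|cd] := eqVneq (c * d)%g 1%g.
  have := rword_uniq (reduced_behead ry).
  set z := (\prod_(a0 <- _) a0)%g => ez.
  have -> : (c * y)%g = z by rewrite -py mulgA cd mul1g.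
  by rewrite ez e/=; split=> //; exists w.
have rr : reduced_word [set` gens A] (c :: d :: rcons w (val a)).
  by apply/reduced_cons; split.
have := rword_uniq rr; rewrite !big_cons py => ez.
by rewrite ez e/=; split; [exists (c :: d :: w)|rewrite ltnW// ltnS leqnSn].
Qed.

Lemma translate_word (w : seq G) a y : (forall c, c \in w -> c \in letters A) ->
  (size w < wlen y)%N -> endset a y ->
  endset a ((\prod_(c <- w) c) * y)%g /\
  (wlen y <= size w + wlen ((\prod_(c <- w) c) * y)%g)%N.
Proof.
elim: w => [|c w ih] h sw ay; first by rewrite big_nil mul1g.
have [||a' l'] := ih _ _ ay.
- by move=> d dw; apply: h; rewrite inE dw orbT.
- exact: ltnW.
set z := ((\prod_(c <- w) c) * y)%g in a' l'.
rewrite big_cons -mulgA -/z.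
have z1 : (1 < wlen z)%N.
  by rewrite -(ltn_add2l (size w)) (leq_trans _ l')// addn1.
have [a'' l''] := translate_letter (h _ (mem_head _ _)) z1 a'.
by split=> //; rewrite (leq_trans l')//= addSnnS leq_add2l.
Qed.

Lemma translate_endset x a y : (wlen x < wlen y)%N -> endset a y ->
  endset a (x * y)%g /\ (wlen y <= wlen x + wlen (x * y)%g)%N.
Proof.
have [[h _] px] := rwordP x.
have := @translate_word (rword x) a y; rewrite px; apply.
by move=> c /h /lettersP.
Qed.

Lemma finite_ball n : finite_set [set x | (wlen x < n)%N].
Proof.
pose p (w : n.-bseq (letters A)) : G := (\prod_(a <- map val w) a)%g.
apply: (@sub_finite_set _ _ (p @` [set: n.-bseq (letters A)])); last first.
  exact/finite_image/finite_finset.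
move=> x /= xn; have [[h _] px] := rwordP x.
have hA : all [in letters A] (rword x).
  by apply/allP => c /h /lettersP.
pose w := pmap (insub : G -> option (letters A)) (rword x).
have ew : map val w = rword x.
  by rewrite /w (pmap_filter (@insubK _ _ _))//; apply/all_filterP;
     apply: sub_all hA => c cA; rewrite /= isSome_insub.
have sw : (size w <= n)%N by rewrite -(size_map val) ew ltnW.
by exists (Bseq sw) => //; rewrite /p/= ew.
Qed.

Definition eventually_long (P : G -> Prop) : Prop :=
  exists N, forall x, (N <= wlen x)%N -> P x.

Lemma eventually_and P Q :
  eventually_long P -> eventually_long Q -> eventually_long (fun x => P x /\ Q x).
Proof.
move=> [N PN] [M QM]; exists (maxn N M) => x; rewrite geq_max => /andP[Nx Mx].
by split; [exact: PN|exact: QM].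
Qed.

Lemma eventually_impl (P Q : G -> Prop) :
  (forall x, P x -> Q x) -> eventually_long P -> eventually_long Q.
Proof. by move=> PQ [N PN]; exists N => x /PN /PQ. Qed.

Lemma eventually_finite P : eventually_long P -> finite_set [set x | ~ P x].
Proof.
move=> [N PN]; apply: sub_finite_set (finite_ball N) => x /= nP.
by rewrite ltnNge; apply/negP => /PN.
Qed.

Lemma a0_subproof : exists a0 : letters A, True.
Proof.
have /fset0Pn[g gA] := gens_neq0 A.
have gL : g \in letters A by rewrite /letters in_fsetU gA.
by exists [` gL]%fset.
Qed.

Definition last_letter x : letters A :=
  xget (projT1 (cid a0_subproof)) [set a | endset a x].

Lemma last_letterP a x : endset a x -> last_letter x = a.
Proof.
move=> ax; rewrite /last_letter; case: xgetP => [b -> /= bx|/(_ a)//].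
exact: endset_inj bx ax.
Qed.

End FreeGroups.

Section MatrixSystems.
Variables (R : realType) (G : groupType).

(* [ms_map b a] is H_{ba} : V_a -> V_b. *)
Record matrix_system (A : free_generators G) := MatrixSystem {
  ms_space : letters A -> vectType R[i];
  ms_map : forall b a, 'Hom(ms_space a, ms_space b);
  ms_map0 : forall a b, (val a * val b)%g = 1%g -> ms_map b a = 0 }.

Record matrix_system_ip (A : free_generators G) := MatrixSystemIp {
  msip_sys :> matrix_system A;
  msip_form : forall a, {dot ms_space msip_sys a for (@Num.conj R[i])};
  msip_compat : forall a (v : ms_space msip_sys a),
    msip_form a v v =
    \sum_(b : letters A)
      msip_form b (ms_map msip_sys b a v) (ms_map msip_sys b a v) }.

Section MultiplicativeFunctions.
Variables (A : free_generators G) (X : matrix_system A).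

(* The disjoint union of the spaces V_a; [tag u = a] means that u lies in V_a. *)
Definition values := {a : letters A & ms_space X a}.

Definition values_step (b : letters A) (u : values) : values :=
  Tagged (ms_space X) (ms_map X b (tag u) (tagged u)).

Definition multiplicative (f : G -> values) : Prop :=
  exists N : nat, forall x, (N <= wlen A x)%N ->
    forall a : letters A, endset a x ->
      tag (f x) = a /\
      forall b : letters A, wlen A (x * val b)%g = (wlen A x).+1 ->
        f (x * val b)%g = values_step b (f x).

Definition almost_equal (f g : G -> values) : Prop :=
  finite_set [set x | f x <> g x].

Definition mfun := {f : G -> values | `[< multiplicative f >]}.

(* The operations are those of V_a when both arguments lie in V_a, which is the
   case at all but finitely many points; elsewhere they are irrelevant. *)
Definition values_add (u v : values) : values :=
  Tagged (ms_space X) (tagged u + tagged_as u v).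
Definition values_opp (u : values) : values :=
  Tagged (ms_space X) (- tagged u).
Definition values_scale (c : R[i]) (u : values) : values :=
  Tagged (ms_space X) (c *: tagged u).
Definition values_zero (a : letters A) : values :=
  Tagged (ms_space X) (0 : ms_space X a).

Lemma almost_equal_refl f : almost_equal f f.
Proof.
by apply: sub_finite_set (finite_set0 G) => x /=.
Qed.

Lemma almost_equal_sym f g : almost_equal f g -> almost_equal g f.
Proof.
by apply: sub_finite_set => x /= h e; apply: h.
Qed.

Lemma almost_equal_trans f g h :
  almost_equal f g -> almost_equal g h -> almost_equal f h.
Proof.
move=> fg gh; apply: (@sub_finite_set _ _
  ([set x | f x <> g x] `|` [set x | g x <> h x])); last first.
  by rewrite finite_setU.
move=> x /= fh; have [e|ne] := pselect (f x = g x); last by left.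
by right; rewrite -e.
Qed.

Lemma eventually_almost_equal f g :
  eventually_long A (fun x => f x = g x) -> almost_equal f g.
Proof. exact: eventually_finite. Qed.

Definition mfun_eq (f g : mfun) : bool := `[< almost_equal (val f) (val g) >].

Lemma mfun_eq_refl : reflexive mfun_eq.
Proof. by move=> f; apply/asboolP/almost_equal_refl. Qed.
Lemma mfun_eq_sym : symmetric mfun_eq.
Proof.
by move=> f g; apply/idP/idP => /asboolP/almost_equal_sym/asboolP.
Qed.
Lemma mfun_eq_trans : transitive mfun_eq.
Proof.
move=> g f h /asboolP fg /asboolP gh.
exact/asboolP/(almost_equal_trans fg gh).
Qed.

Canonical mfun_eq_equiv :=
  EquivRel mfun_eq mfun_eq_refl mfun_eq_sym mfun_eq_trans.

(* Multiplicative functions up to equality at all but finitely many points. *)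
Definition Hinf := {eq_quot mfun_eq}.
HB.instance Definition _ := Choice.on Hinf.
HB.instance Definition _ := EqQuotient.on Hinf.

Definition mfun_apply (f : mfun) : G -> values := val f.
Coercion mfun_apply : mfun >-> Funclass.

Lemma mfunP (f : mfun) : multiplicative f.
Proof. exact/asboolP/(valP f). Qed.

Definition to_mfun f (h : multiplicative f) : mfun :=
  exist (fun f => `[< multiplicative f >]) f (asboolT h).

Lemma mfun_tag (f : mfun) : eventually_long A (fun x => tag (f x) = last_letter A x).
Proof.
have [N h] := mfunP f; exists (maxn N 1) => x; rewrite geq_max => /andP[Nx x0].
have [a ax] := endset_ex x0.
by rewrite (last_letterP ax); have [] := h x Nx a ax.
Qed.

Lemma mfun_large (f : mfun) :
  eventually_long A (fun x => exists v, f x = existT _ (last_letter A x) v).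
Proof.
apply: eventually_impl (mfun_tag f) => x; case: (f x) => a v /= e.
by rewrite -e; exists v.
Qed.

Lemma values_addE a (u v : ms_space X a) :
  values_add (existT _ a u) (existT _ a v) = existT _ a (u + v).
Proof. by rewrite /values_add /= tagged_asE. Qed.

Lemma mfun_add_subproof (f g : mfun) :
  multiplicative (fun x => values_add (f x) (g x)).
Proof.
have [N hf] := mfunP f; have [M hg] := mfunP g.
exists (maxn N M) => x; rewrite geq_max => /andP[Nx Mx] a ax.
have [tf sf] := hf x Nx a ax; have [tg sg] := hg x Mx a ax.
split=> // b l; rewrite sf// sg//.
move: tf tg; case: (f x) => a1 u; case: (g x) => a2 v /= e1 e2.
move: u v; rewrite e1 e2 => u v {sf sg e1 e2}.
by rewrite values_addE [in RHS]/values_step/= values_addE /values_step/= linearD.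
Qed.

Lemma mfun_opp_subproof (f : mfun) : multiplicative (fun x => values_opp (f x)).
Proof.
have [N hf] := mfunP f; exists N => x Nx a ax.
have [tf sf] := hf x Nx a ax; split=> // b l.
by rewrite sf// /values_step/values_opp /= linearN.
Qed.

Lemma mfun_scale_subproof c (f : mfun) :
  multiplicative (fun x => values_scale c (f x)).
Proof.
have [N hf] := mfunP f; exists N => x Nx a ax.
have [tf sf] := hf x Nx a ax; split=> // b l.
by rewrite sf// /values_step/values_scale /= linearZ.
Qed.

Lemma mfun_zero_subproof : multiplicative (fun x => values_zero (last_letter A x)).
Proof.
exists 0%N => x _ a ax; split; first exact: last_letterP.
move=> b l; rewrite (last_letterP (endset_mulr ax l)).
by rewrite /values_step/values_zero /= linear0.
Qed.

(* (pi(x) f)(y) = f(x^-1 y) *)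
Lemma mfun_translate_subproof x (f : mfun) :
  multiplicative (fun y => f (x^-1 * y)%g).
Proof.
have [N hf] := mfunP f; exists (N + (wlen A x^-1%g).+1)%N => y Ny a ay.
have xy : (wlen A x^-1%g < wlen A y)%N by apply: leq_trans Ny; rewrite leq_addl.
have [a' l'] := translate_endset xy ay.
have Nxy : (N <= wlen A (x^-1 * y)%g)%N.
  rewrite -(leq_add2r (wlen A x^-1%g)) [leqRHS]addnC (leq_trans _ l')//.
  by rewrite (leq_trans _ Ny)// leq_add2l.
have [tf sf] := hf _ Nxy a a'; split=> // b /(wlen_mulrP b ay) ab.
by rewrite mulgA sf//; apply/(wlen_mulrP b a').
Qed.

Definition mfun_add f g := to_mfun (mfun_add_subproof f g).
Definition mfun_opp f := to_mfun (mfun_opp_subproof f).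
Definition mfun_scale c f := to_mfun (mfun_scale_subproof c f).
Definition mfun_zero := to_mfun mfun_zero_subproof.
Definition mfun_translate x f := to_mfun (mfun_translate_subproof x f).

Lemma mfun_addE f g x : mfun_add f g x = values_add (f x) (g x).
Proof. by []. Qed.
Lemma mfun_oppE f x : mfun_opp f x = values_opp (f x).
Proof. by []. Qed.
Lemma mfun_scaleE c f x : mfun_scale c f x = values_scale c (f x).
Proof. by []. Qed.
Lemma mfun_zeroE x : mfun_zero x = values_zero (last_letter A x).
Proof. by []. Qed.
Lemma mfun_translateE x f y : mfun_translate x f y = f (x^-1 * y)%g.
Proof. by []. Qed.
Definition mfunE := (mfun_addE, mfun_oppE, mfun_scaleE, mfun_zeroE, mfun_translateE).

Lemma eq_Hinf (f g : mfun) :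
  \pi_Hinf f = \pi_Hinf g <-> almost_equal f g.
Proof.
split=> [/eqmodP/asboolP//|h]; exact/eqmodP/asboolP.
Qed.

Lemma Hinf_repr (f : mfun) : almost_equal (repr (\pi_Hinf f)) f.
Proof. by apply/eq_Hinf; rewrite reprK. Qed.

Definition Hinf_add (F F' : Hinf) : Hinf := \pi_Hinf (mfun_add (repr F) (repr F')).
Definition Hinf_opp (F : Hinf) : Hinf := \pi_Hinf (mfun_opp (repr F)).
Definition Hinf_scale c (F : Hinf) : Hinf := \pi_Hinf (mfun_scale c (repr F)).
Definition Hinf_zero : Hinf := \pi_Hinf mfun_zero.
Definition Hinf_pi x (F : Hinf) : Hinf := \pi_Hinf (mfun_translate x (repr F)).

Lemma almost_equal_add (f f' g g' : mfun) : almost_equal f f' -> almost_equal g g' ->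
  almost_equal (mfun_add f g) (mfun_add f' g').
Proof.
move=> ff' gg'; apply: (@sub_finite_set _ _
  ([set x | f x <> f' x] `|` [set x | g x <> g' x])); last first.
  by rewrite finite_setU.
move=> x ne; have [ef|nf] := pselect (f x = f' x); last by left.
by right=> eg; apply: ne; rewrite !mfunE ef eg.
Qed.

Lemma Hinf_addE (f g : mfun) :
  Hinf_add (\pi_Hinf f) (\pi_Hinf g) = \pi_Hinf (mfun_add f g).
Proof.
by apply/eq_Hinf/almost_equal_add; exact: Hinf_repr.
Qed.

Lemma Hinf_oppE (f : mfun) : Hinf_opp (\pi_Hinf f) = \pi_Hinf (mfun_opp f).
Proof.
apply/eq_Hinf; apply: sub_finite_set (Hinf_repr f) => x ne e; apply: ne.
by rewrite !mfunE e.
Qed.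

Lemma Hinf_scaleE c (f : mfun) :
  Hinf_scale c (\pi_Hinf f) = \pi_Hinf (mfun_scale c f).
Proof.
apply/eq_Hinf; apply: sub_finite_set (Hinf_repr f) => x ne e; apply: ne.
by rewrite !mfunE e.
Qed.

Lemma Hinf_piE x (f : mfun) :
  Hinf_pi x (\pi_Hinf f) = \pi_Hinf (mfun_translate x f).
Proof.
apply/eq_Hinf; have := Hinf_repr f; rewrite /almost_equal.
move=> /(finite_image (fun y => (x * y)%g)); apply: sub_finite_set => y ne.
by exists (x^-1 * y)%g => //; rewrite mulgA mulgV mul1g.
Qed.

Lemma Hinf_ind (P : Hinf -> Prop) : (forall f, P (\pi_Hinf f)) -> forall F, P F.
Proof. by move=> h F; rewrite -[F]reprK; apply: h. Qed.

Lemma Hinf_eventually (f g : mfun) :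
  eventually_long A (fun x => f x = g x) -> \pi_Hinf f = \pi_Hinf g.
Proof. by move=> /eventually_almost_equal/eq_Hinf. Qed.

Lemma Hinf_addA : associative Hinf_add.
Proof.
elim/Hinf_ind=> f; elim/Hinf_ind=> g; elim/Hinf_ind=> h; rewrite !Hinf_addE.
apply: Hinf_eventually; apply: eventually_impl (eventually_and (mfun_large f)
  (eventually_and (mfun_large g) (mfun_large h))) => x [[u fu] [[v gv] [w hw]]].
by rewrite !mfunE fu gv hw !values_addE addrA.
Qed.

Lemma Hinf_addC : commutative Hinf_add.
Proof.
elim/Hinf_ind=> f; elim/Hinf_ind=> g; rewrite !Hinf_addE.
apply: Hinf_eventually; apply: eventually_impl (eventually_and (mfun_large f)
  (mfun_large g)) => x [[u fu] [v gv]].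
by rewrite !mfunE fu gv !values_addE addrC.
Qed.

Lemma Hinf_add0 : left_id Hinf_zero Hinf_add.
Proof.
elim/Hinf_ind=> f; rewrite !Hinf_addE.
apply: Hinf_eventually; apply: eventually_impl (mfun_large f) => x [u fu].
by rewrite !mfunE fu values_addE add0r.
Qed.

Lemma Hinf_addN : left_inverse Hinf_zero Hinf_opp Hinf_add.
Proof.
elim/Hinf_ind=> f; rewrite Hinf_oppE !Hinf_addE.
apply: Hinf_eventually; apply: eventually_impl (mfun_large f) => x [u fu].
by rewrite !mfunE fu values_addE addNr.
Qed.

HB.instance Definition _ :=
  GRing.isZmodule.Build Hinf Hinf_addA Hinf_addC Hinf_add0 Hinf_addN.

Lemma Hinf_addrE (F F' : Hinf) : F + F' = Hinf_add F F'.
Proof. by []. Qed.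

Lemma Hinf_scaleA a b F : Hinf_scale a (Hinf_scale b F) = Hinf_scale (a * b) F.
Proof.
elim/Hinf_ind: F => f; rewrite !Hinf_scaleE; apply: Hinf_eventually.
by exists 0%N => x _; rewrite !mfunE /values_scale/= scalerA.
Qed.

Lemma Hinf_scale1 : left_id 1 Hinf_scale.
Proof.
elim/Hinf_ind=> f; rewrite !Hinf_scaleE; apply: Hinf_eventually.
apply: eventually_impl (mfun_large f) => x [u fu].
by rewrite !mfunE fu /values_scale/= scale1r.
Qed.

Lemma Hinf_scaleDr : right_distributive Hinf_scale +%R.
Proof.
move=> c; elim/Hinf_ind=> f; elim/Hinf_ind=> g.
rewrite !Hinf_addrE Hinf_addE !Hinf_scaleE Hinf_addE.
apply: Hinf_eventually; apply: eventually_impl (eventually_and (mfun_large f)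
  (mfun_large g)) => x [[u fu] [v gv]].
by rewrite !mfunE fu gv /values_scale !values_addE/= scalerDr.
Qed.

Lemma Hinf_scaleDl F : {morph Hinf_scale^~ F : a b / a + b}.
Proof.
elim/Hinf_ind: F => f a b /=.
rewrite Hinf_addrE !Hinf_scaleE Hinf_addE.
apply: Hinf_eventually; apply: eventually_impl (mfun_large f) => x [u fu].
by rewrite !mfunE fu /values_scale !values_addE/= scalerDl.
Qed.

HB.instance Definition _ := GRing.Zmodule_isLmodule.Build R[i] Hinf
  Hinf_scaleA Hinf_scale1 Hinf_scaleDr Hinf_scaleDl.

End MultiplicativeFunctions.

Section InnerProduct.
Variables (A : free_generators G) (X : matrix_system_ip A).

(* B_a(u, v) when u and v lie in the same V_a, as they do on large spheres. *)
Definition values_form (u v : values X) : R[i] :=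
  msip_form X (tag u) (tagged u) (tagged_as u v).

Definition sphere_sum (N : nat) (f g : G -> values X) : R[i] :=
  \sum_(x \in [set x | wlen A x = N])
    \sum_(a : letters A | wlen A (x * val a)%g == (wlen A x).+1)
      values_form (f (x * val a)%g) (g (x * val a)%g).

(* The common value of the sums over all large spheres; these are eventually
   constant, so the default 0 is never used. *)
Definition Hinf_dotp (F F' : Hinf X) : R[i] :=
  xget 0 [set c | exists N0, forall N, (N0 <= N)%N ->
                    sphere_sum N (repr F) (repr F') = c].

End InnerProduct.
End MatrixSystems.

HB.mixin Record isHilbert (R : realType) V of CompleteNormedModule R[i] V := {
  dotp : {dot V for (@Num.conj R[i])};
  dotp_norm : forall v : V, `|v| ^+ 2 = dotp v v }.

#[short(type="hilbertType")]
HB.structure Definition Hilbert (R : realType) :=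
  {V of CompleteNormedModule R[i] V & isHilbert R V}.

Record unitary_rep (R : realType) (G : groupType) (H : hilbertType R) :=
  UnitaryRep {
    rep_map :> G -> {linear H -> H};
    rep1 : forall v, rep_map 1%g v = v;
    repM : forall x y v, rep_map (x * y)%g v = rep_map x (rep_map y v);
    rep_dotp : forall x u v, dotp (rep_map x u) (rep_map x v) = dotp u v }.

(* A Hilbert space in which V embeds isometrically with dense range, hence
   determined up to a unique unitary isomorphism compatible with the embedding. *)
Record hilbert_completion (R : realType) (V : lmodType R[i])
    (form : V -> V -> R[i]) := HilbertCompletion {
  completion_space :> hilbertType R;
  completion_embed : {linear V -> completion_space};
  completion_isometry : forall u v,
    dotp (completion_embed u) (completion_embed v) = form u v;
  completion_dense : dense (range completion_embed) }.

Definition unitary_operator (R : realType) (H K : hilbertType R)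
    (U : {linear H -> K}) : Prop :=
  bijective U /\ forall u v, dotp (U u) (U v) = dotp u v.

Definition linear_subspace (R : realType) (H : hilbertType R) (M : set H) : Prop :=
  M 0 /\ forall c u v, M u -> M v -> M (c *: u + v).

Definition Mult (R : realType) (G : groupType) (H : hilbertType R)
    (rho : unitary_rep G H) : Prop :=
  exists (A : free_generators G) (X : matrix_system_ip R A)
         (K : hilbert_completion (@Hinf_dotp R G A X))
         (M : set H) (U : {linear H -> K}),
    [/\ linear_subspace M, dense M, unitary_operator U,
        U @` M = range (completion_embed K)
      & forall x m F, M m -> U m = completion_embed K F ->
          U (rho x m) = completion_embed K (Hinf_pi x F)].

Section Restriction.
Variables (R : realType) (G : groupType) (P : pred G) (K : subGroupType P).
Variables (H : hilbertType R) (rho : unitary_rep G H).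

Definition restriction_map (h : K) : {linear H -> H} := rho (val h).

Lemma restriction1 v : restriction_map 1%g v = v.
Proof. by rewrite /restriction_map (val1 K : val 1%g = 1%g) rep1. Qed.

Lemma restrictionM x y v :
  restriction_map (x * y)%g v = restriction_map x (restriction_map y v).
Proof.
by rewrite /restriction_map (valM x y : val (x * y)%g = (val x * val y)%g) repM.
Qed.

Definition restricted_rep : unitary_rep K H :=
  UnitaryRep restriction1 restrictionM (fun h => rep_dotp rho (val h)).

End Restriction.

Section DotTheory.
Variables (C : numClosedFieldType) (V : lmodType C) (form : {dot V for (@Num.conj C)}).

Lemma dot_CauchySchwarz u v : `|form u v| ^+ 2 <= form u u * form v v.
Proof.
have [-> | nz_v] := eqVneq v 0; first by rewrite !linear0r normr0 expr0n mulr0.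
have vv : 0 < form v v by rewrite dnorm_gt0.
pose a := form u v / form v v; pose u1 := u - a *: v.
have ou : form u1 v = 0.
  by rewrite /u1 linearBl/= linearZl_LR/= divfK ?gt_eqF// subrr.
have -> : form u v = a * form v v by rewrite /a divfK// gt_eqF.
have -> : u = u1 + a *: v by rewrite subrK.
rewrite hnormDd/=; last by rewrite linearZr_LR/= ou mulr0.
rewrite dnormZ normrM exprMn (gtr0_norm vv) expr2 mulrA mulrDl.
by rewrite -mulrA lerDr mulr_ge0// dnorm_ge0.
Qed.

Lemma dot_triangle u v :
  sqrtC (form (u + v) (u + v)) <= sqrtC (form u u) + sqrtC (form v v).
Proof.
have s0 w : 0 <= sqrtC (form w w) by rewrite sqrtC_ge0 dnorm_ge0.
rewrite -(@ler_pXn2r _ 2)// ?nnegrE ?addr_ge0// [leRHS]sqrrD !sqrtCK dnormD.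
rewrite [leRHS]addrAC lerD2l -mulr_natr.
rewrite -[leLHS](divfK (negbT (pnatr_eq0 C 2))) ler_pM2r ?ltr0n//.
rewrite -ReE (le_trans (leif_Re_Creal _))//.
rewrite -(@ler_pXn2r _ 2)// ?nnegrE ?mulr_ge0// exprMn !sqrtCK.
exact: dot_CauchySchwarz.
Qed.

End DotTheory.

Lemma mulrn_lt_sqr (C : numFieldType) (d e : C) n :
  0 < d -> e = d * n.+1%:R -> d ^+ 2 *+ n < e ^+ 2.
Proof.
move=> d0 ->; have d2 : 0 < d ^+ 2 by rewrite exprn_gt0.
rewrite exprMn -[ltLHS]mulr_natr ltr_pM2l// -natrX ltr_nat.
by rewrite expnS expn1 mulSn ltn_addr.
Qed.

Section Cosets.
Variables (G : groupType) (P : pred G) (K : subGroupType P).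

Definition left_coset (x : G) : set G := [set (x * val h)%g | h in [set: K]].

Definition left_cosets : set (set G) := range left_coset.

Definition finite_index : Prop := finite_set left_cosets.

Definition coset_rep (c : set G) : G := xget 1%g c.

Lemma coset_repP g : exists h : K, g = (coset_rep (left_coset g) * val h)%g.
Proof.
rewrite /coset_rep; case: xgetP => [y _ [h _ <-]|/(_ g)[]].
  exists h^-1%g; rewrite -mulgA -(valM h h^-1%g) mulgV.
  by rewrite (val1 K : val 1%g = 1%g) mulg1.
by exists 1%g => //; rewrite (val1 K : val 1%g = 1%g) mulg1.
Qed.

Lemma left_cosetM (g : G) (h : K) : left_coset (g * val h)%g = left_coset g.
Proof.
apply/seteqP; split=> x [k _ <-].
  by exists (h * k)%g => //; rewrite (valM h k : val _ = (_ * _)%g) mulgA.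
exists (h^-1 * k)%g => //.
by rewrite -mulgA -(valM h _ : val _ = (_ * _)%g) mulVKg.
Qed.

Lemma left_coset_rep c : left_cosets c -> left_coset (coset_rep c) = c.
Proof. by move=> [g _ <-]; have [h {2}->] := coset_repP g; rewrite left_cosetM. Qed.

Definition translate_set (x : G) (c : set G) : set G := [set (x * g)%g | g in c].

Lemma translate_left_coset x g : translate_set x (left_coset g) = left_coset (x * g)%g.
Proof.
apply/seteqP; split=> [y [_ [h _ <-] <-]|y [h _ <-]].
  by exists h => //; rewrite mulgA.
by exists (g * val h)%g; [exists h|rewrite mulgA].
Qed.

Lemma translate_setK x : cancel (translate_set x) (translate_set x^-1%g).
Proof.
move=> c; apply/seteqP; split=> [y [_ [g cg <-] <-]|y cy].
  by rewrite mulKg.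
by exists (x * y)%g; [exists y|rewrite mulKg].
Qed.

Lemma translate_bij x : set_bij left_cosets left_cosets (translate_set x).
Proof.
split.
- by move=> _ [g _ <-] /=; rewrite translate_left_coset; exists (x * g)%g.
- by move=> c d _ _; exact: (can_inj (translate_setK x)).
- move=> _ [g _ <-]; exists (left_coset (x^-1 * g)%g); first by exists (x^-1 * g)%g.
  by rewrite translate_left_coset mulVKg.
Qed.

End Cosets.

Section Induction.
Variables (R : realType) (G : groupType) (P : pred G) (K : subGroupType P).
Variables (H : hilbertType R) (rho : unitary_rep K H).

Definition equivariant (f : G -> H) : Prop :=
  forall (h : K) (g : G), rho h (f g) = f (g * (val h)^-1)%g.

Definition ind_pred : {pred G -> H} := [pred f | `[< equivariant f >]].

Lemma ind_pred_closed : submod_closed ind_pred.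
Proof.
split; first by apply/asboolP => h g; rewrite linear0.
move=> c f f' /asboolP ef /asboolP ef'; apply/asboolP => h g.
by rewrite !fctE linearP ef ef'.
Qed.
HB.instance Definition _ :=
  GRing.isSubmodClosed.Build R[i] (G -> H) ind_pred ind_pred_closed.

(* The finite index makes the sums over cosets below finite, hence
   the space complete. *)
Record ind_space (fin : finite_index K) := IndSpace {
  ind_fun :> G -> H;
  ind_funP : ind_fun \in ind_pred }.

Variable fin : finite_index K.

HB.instance Definition _ := [isSub for @ind_fun fin].
HB.instance Definition _ := [Choice of ind_space fin by <:].
HB.instance Definition _ := [SubChoice_isSubLmodule of ind_space fin by <:].

Definition ind_dotp (f f' : ind_space fin) : R[i] :=
  \sum_(c \in left_cosets K) dotp (f (coset_rep c)) (f' (coset_rep c)).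

Let reps := fset_set (left_cosets K).

Lemma ind_dotpE f f' :
  ind_dotp f f' = \sum_(c <- reps) dotp (f (coset_rep c)) (f' (coset_rep c)).
Proof. exact: fsbig_finite. Qed.

Lemma ind_addE (f f' : ind_space fin) g : (f + f') g = f g + f' g.
Proof. by []. Qed.
Lemma ind_scaleE c (f : ind_space fin) g : (c *: f) g = c *: f g.
Proof. by []. Qed.
Lemma ind_oppE (f : ind_space fin) g : (- f) g = - f g.
Proof. by []. Qed.

Lemma ind_equivariant (f : ind_space fin) : equivariant f.
Proof. exact/asboolP/(ind_funP f). Qed.

Lemma ind_coset (f : ind_space fin) g (h : K) :
  f (g * val h)%g = rho h^-1%g (f g).
Proof.
rewrite ind_equivariant; congr (f (_ * _)%g).
apply: (@mulIg _ (val h^-1%g)).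
by rewrite -(valM h h^-1%g : val _ = (_ * _)%g) mulgV mulVg; exact: val1.
Qed.

Lemma ind_dotp_coset (f f' : ind_space fin) g :
  dotp (f (coset_rep (left_coset K g))) (f' (coset_rep (left_coset K g))) =
  dotp (f g) (f' g).
Proof.
by have [h {3 4}->] := coset_repP K g; rewrite !ind_coset rep_dotp.
Qed.

Lemma ind_dotp_bilinear :
  bilinear_for (GRing.Scale.Law.clone _ _ *%R _)
    (GRing.Scale.Law.clone _ _ ((@Num.conj R[i]) \; *%R) _) ind_dotp.
Proof.
split=> [f'|f] c u v; rewrite !ind_dotpE /= mulr_sumr -big_split /=;
  apply: eq_bigr => x _.
  by rewrite linearPl.
by rewrite linearPr.
Qed.
HB.instance Definition _ := bilinear_isBilinear.Build R[i] (ind_space fin)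
  (ind_space fin) R[i] _ _ ind_dotp ind_dotp_bilinear.

Lemma ind_dotp_herm (f f' : ind_space fin) :
  ind_dotp f f' = (-1) ^+ false * Num.conj (ind_dotp f' f).
Proof.
rewrite !ind_dotpE mul1r rmorph_sum /=; apply: eq_bigr => c _.
by rewrite hermC mul1r.
Qed.
HB.instance Definition _ := isHermitianSesquilinear.Build R[i] (ind_space fin)
  false (@Num.conj R[i]) ind_dotp ind_dotp_herm.

Lemma ind_le (f : ind_space fin) g : dotp (f g) (f g) <= ind_dotp f f.
Proof.
rewrite -ind_dotp_coset ind_dotpE.
have gr : left_coset K g \in reps by rewrite in_fset_set// inE; exists g.
rewrite (big_fsetD1 _ gr) /= lerDl.
by rewrite big_seq_cond sumr_ge0// => c _; exact: dnorm_ge0.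
Qed.

Lemma ind_dotp_gt0 (f : ind_space fin) : f != 0 -> 0 < ind_dotp f f.
Proof.
move=> f0; have [g fg] : exists g, f g != 0.
  apply: contrapT => /forallNP h; move/eqP: f0; apply; apply/val_inj/funext => g.
  by have /negP := h g; rewrite negbK => /eqP.
by apply: lt_le_trans (ind_le f g); rewrite dnorm_gt0.
Qed.
HB.instance Definition _ := isDotProduct.Build R[i] (ind_space fin) ind_dotp ind_dotp_gt0.

Definition ind_norm (f : ind_space fin) : R[i] := sqrtC (ind_dotp f f).

Lemma ind_normD f f' : ind_norm (f + f') <= ind_norm f + ind_norm f'.
Proof. exact: dot_triangle. Qed.

Lemma ind_normZ c f : ind_norm (c *: f) = `|c| * ind_norm f.
Proof.
by rewrite /ind_norm dnormZ sqrtCM ?nnegrE ?exprn_ge0 ?dnorm_ge0// sqrCK.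
Qed.

Lemma ind_norm_eq0 f : ind_norm f = 0 -> f = 0.
Proof. by move/eqP; rewrite sqrtC_eq0 dnorm_eq0 => /eqP. Qed.

HB.instance Definition _ := Lmodule_isNormed.Build R[i] (ind_space fin)
  ind_normD ind_normZ ind_norm_eq0.

Lemma ind_normE (f : ind_space fin) : `|f| ^+ 2 = ind_dotp f f.
Proof. by rewrite [ `|f| ]/(ind_norm f) sqrtCK. Qed.

Lemma ind_norm_le (f : ind_space fin) g : `|f g| <= `|f|.
Proof.
by rewrite -(@ler_pXn2r _ 2)// ?nnegrE// dotp_norm ind_normE ind_le.
Qed.

Lemma ind_complete (F : set_system (ind_space fin)) :
  ProperFilter F -> cauchy F -> cvg F.
Proof.
move=> FF cF.
have cg g : cvg ((fun f : ind_space fin => f g) @ F).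
  apply: cauchy_cvg; apply/cauchy_ballP => e e0.
  have /cauchy_ballP/(_ e e0) := cF.
  rewrite /= !near_map2; apply: filterS => -[x y] /=.
  rewrite -!ball_normE /=; apply: le_lt_trans.
  by have := ind_norm_le (x - y) g; rewrite ind_addE ind_oppE.
pose L g := lim ((fun f : ind_space fin => f g) @ F).
have LE : equivariant L.
  move=> h g; apply: (@cvg_unique _ (@norm_hausdorff _ _)
    ((fun f : ind_space fin => f (g * (val h)^-1)%g) @ F)) => //; last exact: cg.
  have -> : (fun f : ind_space fin => f (g * (val h)^-1)%g) =
            (fun f : ind_space fin => rho h (f g)).
    by apply/funext => f; rewrite ind_equivariant.
  apply/cvgrPdist_lt => e e0; have /cvgrPdist_lt/(_ e e0) := cg g.
  apply: filterS => f; rewrite -raddfB /=; apply: le_lt_trans.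
  by rewrite -(@ler_pXn2r _ 2)// ?nnegrE// !dotp_norm rep_dotp.
pose LI : ind_space fin := IndSpace fin (asboolT LE).
apply/cvg_ex; exists LI; apply/fcvgrPdist_lt => e e0.
pose n := size reps; pose d := e / n.+1%:R.
have d0 : 0 < d by rewrite divr_gt0.
have := @filter_bigI _ _ reps
  (fun c => [set f : ind_space fin | `|L (coset_rep c) - f (coset_rep c)| < d]) F _.
move=> /(_ _ _)/filterS; apply; last first.
  by move=> c _; have /cvgrPdist_lt/(_ d d0) := cg (coset_rep c).
move=> f /= fc; rewrite -(@ltr_pXn2r _ 2)// ?nnegrE ?(ltW e0)//.
rewrite [X in X < _](ind_normE (LI - f)) ind_dotpE.
apply: (@le_lt_trans _ _ (\sum_(c <- reps) d ^+ 2)).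
  rewrite big_seq [leRHS]big_seq; apply: ler_sum => c cr.
  rewrite -dotp_norm ler_pXn2r// ?nnegrE ?(ltW d0)//.
  by have /ltW := fc c cr; rewrite ind_addE ind_oppE.
rewrite big_const_seq count_predT iter_addr_0 -/n.
by apply: mulrn_lt_sqr d0 _; rewrite /d divfK// pnatr_eq0.
Qed.

HB.instance Definition _ := Uniform_isComplete.Build (ind_space fin) ind_complete.
HB.instance Definition _ := isHilbert.Build R (ind_space fin) ind_normE.

Lemma ind_map_subproof (g0 : G) (f : ind_space fin) :
  (fun g => f (g0^-1 * g)%g) \in ind_pred.
Proof. by apply/asboolP => h g; rewrite ind_equivariant mulgA. Qed.

Definition ind_map (g0 : G) (f : ind_space fin) : ind_space fin :=
  IndSpace fin (ind_map_subproof g0 f).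

Lemma ind_map_linear g0 : linear (ind_map g0).
Proof. by move=> c u v; apply/val_inj. Qed.
HB.instance Definition _ g0 := GRing.isLinear.Build R[i] (ind_space fin)
  (ind_space fin) *:%R (ind_map g0) (ind_map_linear g0).

Definition ind_lin (g0 : G) : {linear ind_space fin -> ind_space fin} := ind_map g0.

Lemma ind1 f : ind_lin 1%g f = f.
Proof. by apply/val_inj/funext => g /=; rewrite invg1 mul1g. Qed.

Lemma indM x y f : ind_lin (x * y)%g f = ind_lin x (ind_lin y f).
Proof. by apply/val_inj/funext => g /=; rewrite invgM mulgA. Qed.

Lemma ind_lin_dotp x f f' : dotp (ind_lin x f) (ind_lin x f') = dotp f f'.
Proof.
rewrite [LHS]/(ind_dotp _ _) [RHS]/(ind_dotp _ _) /ind_dotp.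
rewrite [RHS](reindex_fsbig _ _ _ _ (translate_bij K x^-1%g)).
apply: eq_fsbigr => c; rewrite inE => cK /=.
by rewrite -[in RHS](left_coset_rep cK) translate_left_coset ind_dotp_coset.
Qed.

(* (Ind(g0) f)(g) = f(g0^-1 g) *)
Definition induced_rep : unitary_rep G (ind_space fin) :=
  UnitaryRep ind1 indM ind_lin_dotp.

End Induction.

(* Main.v *)
Require Import Defs.
From HB Require Import structures.
From mathcomp Require Import all_boot all_order all_algebra finmap complex.
From mathcomp Require Import boolp classical_sets functions cardinality fsbigop.
From mathcomp Require Import reals topology normedtype.

(* Write W_a for the space of values V_a, placed in H as the multiplicative
   functions supported beyond the letter a.  Up to unitary equivalence, a
   representation in Mult is the same thing as a family of finite dimensional
   subspaces W_a of H such that W_a lies in the sum of the rho(a) W_b with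
   ab <> e, the translates rho(x) W_a and rho(y) W_b are orthogonal as soon as
   the cones beyond the corresponding edges of the Cayley tree are disjoint, and
   all translates span a dense subspace.  For the converse, orthonormal bases of
   the W_a give the matrix system, and a multiplicative function f is sent to the
   common value of the sums of f over large spheres.

   Such a family is carried from one tree to another as follows.  Let (y, a) be
   an edge of the forest G x A1 on which G1 acts on the right, with its space
   W_(y,a).  Each cone of the tree of G2 pulls back to a subset of G with finite
   boundary, so it contains only finitely many maximal source cones, and the sum
   of the spaces of these is the new space of the cone.  Maximality makes the
   construction equivariant and compatible with passing to smaller cones, for
   arbitrary bases A1 and A2.  Restriction is the case where G1 = G and G2 = K is
   the subgroup; induction is the case where G1 = K and G2 = G, with W_(y,a)
   supported on the coset y K.  A basis of K is provided by a Schreier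
   transversal and ping-pong on the cones leaving it. *)

Set Implicit Arguments.
Unset Strict Implicit.
Unset Printing Implicit Defensive.

Import Order.TTheory GRing.Theory Num.Theory.
Import numFieldNormedType.Exports.

Local Open Scope classical_set_scope.
Local Open Scope ring_scope.
Local Open Scope quotient_scope.

(** * Reduced words *)

Section Words.
Variables (G : groupType) (A : free_generators G).
Implicit Types (x y z u h : G) (a b c : letters A) (w : seq G).
Local Open Scope group_scope.

Lemma letter_inv_subproof a : (val a)^-1 \in letters A.
Proof.
have /lettersP[aS|[s sS sa]] := valP a; apply/lettersP.
  by right; exists (val a).
by left; rewrite -sa invgK.
Qed.

Definition letter_inv a : letters A := [` letter_inv_subproof a]%fset.

Lemma val_letter_inv a : val (letter_inv a) = (val a)^-1. Proof. by []. Qed.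

Lemma letter_invK : involutive letter_inv.
Proof. by move=> a; apply/val_inj; rewrite /= invgK. Qed.

Lemma letter_mul_eq1 a b : (val a * val b == 1) = (b == letter_inv a).
Proof.
apply/eqP/eqP => [e|->]; last by rewrite val_letter_inv mulgV.
by apply/val_inj; rewrite val_letter_inv -[RHS]mulg1 -e mulKg.
Qed.

Lemma rword1 : rword A 1 = [::].
Proof. by have := @rword_uniq G A [::]; rewrite big_nil; apply; split. Qed.

Lemma wlen1 : wlen A 1 = 0%N.
Proof. by rewrite /wlen rword1. Qed.

Lemma wlen_eq0 x : wlen A x = 0%N -> x = 1.
Proof. by move/size0nil => e; have [_ <-] := rwordP A x; rewrite e big_nil. Qed.

Lemma rwordV x : rword A x^-1 = rev (map (fun g => g^-1) (rword A x)).
Proof.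
have [[hl hs] hx] := rwordP A x.
have e : (\prod_(g <- rev (map (fun g => g^-1) (rword A x))) g)%g = x^-1.
  rewrite -{2}hx; elim: (rword A x) => [|g w ih]; first by rewrite !big_nil invg1.
  by rewrite /= rev_cons -cats1 big_cat big_seq1 /= ih big_cons invgM.
rewrite -{1}e; apply: rword_uniq; split.
  move=> g; rewrite mem_rev => /mapP[b bw ->].
  have /lettersP bA := hl _ bw.
  exact/lettersP/(letter_inv_subproof [` bA]%fset).
rewrite rev_sorted sorted_map; apply: sub_sorted hs => g h /= gh.
by rewrite -invgM; apply: contraNneq gh => /(congr1 (fun x => x^-1)); rewrite invgK invg1 => ->.
Qed.

Lemma wlenV x : wlen A x^-1 = wlen A x.
Proof. by rewrite /wlen rwordV size_rev size_map. Qed.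

Definition startset a : set G := [set x | exists w, rword A x = val a :: w].

Lemma startset_endset a x : startset a x <-> endset (letter_inv a) x^-1.
Proof.
split=> -[w e].
  by exists (rev (map (fun g => g^-1) w)); rewrite rwordV e /= rev_cons.
exists (rev (map (fun g => g^-1) w)).
by rewrite -[x]invgK rwordV e map_rcons rev_rcons /= invgK.
Qed.

Lemma startset_inj a b x : startset a x -> startset b x -> a = b.
Proof. by move=> [w e] [w']; rewrite e => -[/val_inj]. Qed.

Lemma startset_ex x : x != 1 -> exists a, startset a x.
Proof.
move=> x1; have : (0 < wlen A x^-1)%N.
  by rewrite wlenV lt0n; apply: contraNneq x1 => /wlen_eq0 ->.
move=> /endset_ex[a ax]; exists (letter_inv a).
by apply/startset_endset; rewrite letter_invK.
Qed.

Lemma startset_neq1 a x : startset a x -> x <> 1.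
Proof. by move=> [w e] x1; move: e; rewrite x1 rword1. Qed.

Lemma rword_letter a : rword A (val a) = [:: val a].
Proof.
have := @rword_uniq G A [:: val a]; rewrite big_seq1; apply; split=> //.
by move=> b; rewrite inE => /eqP ->; apply/lettersP/valP.
Qed.

Lemma startset_letter a : startset a (val a).
Proof. by exists [::]; rewrite rword_letter. Qed.

Lemma endset_letter a : endset a (val a).
Proof. by exists [::]; rewrite rword_letter. Qed.

Lemma wlen_letter a : wlen A (val a) = 1%N.
Proof. by rewrite /wlen rword_letter. Qed.

Lemma rword_startV a x : startset a x -> rword A x = val a :: rword A ((val a)^-1 * x).
Proof.
move=> [w e]; have [rx px] := rwordP A x; rewrite e in rx px.
rewrite e; congr (_ :: _).
by rewrite -px big_cons mulKg rword_uniq//; exact: reduced_behead rx.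
Qed.

(** Prepending [a^-1] to the reduced word of x either cancels its first letter or gives a reduced
    word. In the Cayley tree, the complement of a cone is thus the cone of the reversed edge. *)
Lemma startset_compl a x :
  startset (letter_inv a) ((val a)^-1 * x) <-> ~ startset a x.
Proof.
split=> [[w e] ax|nax].
  have [[_]] := rwordP A x; rewrite (rword_startV ax) e /= mulgV.
  by rewrite eqxx.
exists (rword A x); have [rx px] := rwordP A x.
have := @rword_uniq G A ((val a)^-1 :: rword A x).
rewrite big_cons px; apply.
move: rx nax; rewrite /startset /=; case E: (rword A x) => [|b w] rx nax.
  by split=> // c; rewrite inE => /eqP ->; apply/lettersP/letter_inv_subproof.
apply/reduced_cons; split=> //; first exact: letter_inv_subproof.
apply/eqP => ab; apply: nax; exists w; congr (_ :: _).
by rewrite -[RHS]mulg1 -ab mulVKg.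
Qed.

Lemma startset_mulr a x h : (wlen A h < wlen A x)%N ->
  startset a x -> startset a (x * h).
Proof.
move=> hx /startset_endset ax; apply/startset_endset; rewrite invgM.
by apply: (translate_endset _ ax).1; rewrite !wlenV.
Qed.

(** The edge from x to x b of the Cayley tree points away from 1. *)
Definition ext x b := wlen A (x * val b) = (wlen A x).+1.

Lemma ext1 b : ext 1 b.
Proof. by rewrite /ext mul1g wlen1 wlen_letter. Qed.

Lemma extP a b x : endset a x -> (ext x b <-> (val a * val b != 1)).
Proof. exact: wlen_mulrP. Qed.

Lemma rword_ext x b : ext x b -> rword A (x * val b) = rcons (rword A x) (val b).
Proof.
have [->|x1] := eqVneq x 1; first by rewrite mul1g rword_letter rword1.
have /endset_ex[a ax] : (0 < wlen A x)%N.
  by rewrite lt0n; apply: contraNneq x1 => /wlen_eq0 ->.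
by move=> /(extP b ax) /(rword_mulr ax).
Qed.

Lemma endset_ext x b : ext x b -> endset b (x * val b).
Proof. by move=> xb; exists (rword A x); rewrite rword_ext. Qed.

Lemma startset_ext a x b : startset a x -> ext x b -> startset a (x * val b).
Proof.
by move=> [w e] xb; exists (rcons w (val b)); rewrite rword_ext// e.
Qed.

Lemma endset_split b x : endset b x ->
  ext (x * (val b)^-1) b /\ wlen A x = (wlen A (x * (val b)^-1)).+1.
Proof.
move=> bx; have := wlen_mulr_cancel (b := letter_inv b) bx (mulgV _).
by rewrite val_letter_inv /ext => e; rewrite mulgVK -e.
Qed.

Lemma ext_ind (Q : G -> Prop) : Q 1 ->
  (forall x b, ext x b -> Q x -> Q (x * val b)) -> forall x, Q x.
Proof.
move=> Q1 Qext x; have [n] := ubnP (wlen A x); elim: n x => // n ih x xn.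
have [x0|/endset_ex[b bx]] := posnP (wlen A x); first by rewrite (wlen_eq0 x0).
have [xb l] := endset_split bx; rewrite -[x](mulgVK (val b)).
by apply: Qext => //; apply: ih; rewrite -ltnS -l.
Qed.

Lemma rword_cat u c z : ext u c -> startset c z ->
  rword A (u * z) = rword A u ++ rword A z.
Proof.
move=> uc cz; have := rword_startV cz; move: (rword A (_^-1 * z)) => t e.
have [[hu su] pu] := rwordP A u; have [[hz sz] pz] := rwordP A z.
have -> : u * z = (\prod_(g <- rword A u ++ rword A z) g)%g by rewrite big_cat /= pu pz.
apply: rword_uniq; split.
  by move=> a; rewrite mem_cat => /orP[/hu|/hz].
have [[_ suc] _] := rwordP A (u * val c); rewrite rword_ext// in suc.
rewrite e in sz *; case: (rword A u) suc => [//|d w] /=.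
by rewrite rcons_path cat_path /= => /andP[-> ->].
Qed.

Lemma wlen_cat u c z : ext u c -> startset c z ->
  wlen A (u * z) = (wlen A u + wlen A z)%N.
Proof. by move=> uc cz; rewrite /wlen (rword_cat uc cz) size_cat. Qed.

Lemma startset_step a x : startset a x ->
  x = val a \/ exists c, val a * val c != 1 /\ startset c ((val a)^-1 * x).
Proof.
move=> ax; have [e|ne] := eqVneq ((val a)^-1 * x) 1.
  by left; rewrite -[RHS]mulg1 -e mulVKg.
right; have [c cx] := startset_ex ne; exists c; split=> //.
rewrite letter_mul_eq1; apply/eqP => e; move: cx; rewrite e.
by move/startset_compl; apply.
Qed.

Lemma startset_mull a c x : val a * val c != 1 -> startset c x ->
  startset a (val a * x).
Proof.
move=> ac cx; apply: contrapT => /startset_compl; rewrite mulKg => h.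
by move: ac; rewrite letter_mul_eq1 (startset_inj cx h) eqxx.
Qed.

Lemma startset_ind a (Q : G -> Prop) : Q (val a) ->
  (forall x b, startset a x -> ext x b -> Q x -> Q (x * val b)) ->
  forall x, startset a x -> Q x.
Proof.
move=> Qa Qext x; elim/ext_ind: x => [/startset_neq1//|x b xb ih].
have [->|/startset_ex[c cx]] := eqVneq x 1.
  rewrite mul1g => h; have <- : a = b; last by [].
  exact: startset_inj h (startset_letter b).
move=> h; have := startset_inj h (startset_ext cx xb) => e.
by rewrite -e in cx; apply: Qext => //; exact: ih.
Qed.

Lemma ext_startset x b c z : ext x b -> startset b z -> ext z c -> ext (x * z) c.
Proof.
move=> xb bz zc; rewrite /ext -mulgA (wlen_cat xb (startset_ext bz zc)).
by rewrite (wlen_cat xb bz) zc addnS.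
Qed.

(** An involutive letter would lie in both S and S^-1, which [free_basis] keeps disjoint. *)
Lemma letter_inv_neq a :
  letter_inv a != a.
Proof.
apply/eqP => aa; have aV : val a = (val a)^-1 by rewrite -val_letter_inv aa.
have gA : val a \in gens A.
  by have /lettersP[//|[c cA cV]] := valP a; rewrite aV -cV invgK.
have : ([set` gens A] `&` [set x^-1 | x in [set` gens A]]) (val a).
  by split=> //; exists (val a).
by have [-> _] := gens_free A.
Qed.

Lemma wlen_unbounded a n :
  exists2 x, startset a x & wlen A x = n.+1.
Proof.
elim: n => [|n [x ax xn]].
  by exists (val a); [exact: startset_letter|rewrite wlen_letter].
have [|c cx] := @endset_ex _ A x; first by rewrite xn.
(* The last letter can always be repeated, since it differs from its inverse. *)
have xc : ext x c by apply/(extP _ cx); rewrite letter_mul_eq1 eq_sym letter_inv_neq.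
by exists (x * val c); [exact: startset_ext|rewrite xc xn].
Qed.

End Words.

(** * Sums over spheres of the Cayley tree *)

Section Spheres.
Variables (G : groupType) (A : free_generators G) (V : zmodType).
Implicit Types (x y z : G) (a b c : letters A) (W : G -> V).

Lemma finite_sphere N : finite_set [set x | wlen A x = N].
Proof. by apply: sub_finite_set (finite_ball A N.+1) => x /= ->. Qed.

Definition sphere N : seq G := fset_set [set x | wlen A x = N].

Lemma mem_sphere N x : (x \in sphere N) = (wlen A x == N).
Proof.
rewrite [LHS]in_fset_set; last exact: finite_sphere.
by apply/idP/eqP; rewrite inE.
Qed.

Lemma sphere_uniq N : uniq (sphere N).
Proof. exact: fset_uniq. Qed.

Lemma sum_sphereS N W : \sum_(x <- sphere N.+1) W x =
  \sum_(x <- sphere N) \sum_(b : letters A | wlen A (x * val b)%g == (wlen A x).+1)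
    W (x * val b)%g.
Proof.
pose e (p : G * letters A) := (p.1 * val p.2)%g.
pose s := [seq p <- [seq (x, b) | x <- sphere N, b <- index_enum (letters A)]
           | wlen A (e p) == (wlen A p.1).+1].
have -> : \sum_(x <- sphere N.+1) W x = \sum_(p <- s) W (e p).
  rewrite -(big_map e xpredT); apply: perm_big; apply: uniq_perm.
  - exact: sphere_uniq.
  - rewrite map_inj_in_uniq.
      rewrite filter_uniq// allpairs_uniq ?sphere_uniq ?index_enum_uniq//.
      by move=> [x b] [y c].
    move=> [x b] [y c]; rewrite !mem_filter => /andP[/eqP /= xb _] /andP[/eqP /= yc _] exy.
    have := endset_ext (xb : ext x b); rewrite [(x * _)%g]exy => bx.
    have bc := endset_inj bx (endset_ext (yc : ext y c)).
    by move: exy; rewrite bc /e /= => /mulIg ->.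
  move=> x; rewrite mem_sphere; apply/eqP/mapP => [xN|[[y b]]].
    have [|b bx] := @endset_ex _ A x; first by rewrite xN.
    have [xb l] := endset_split bx.
    exists ((x * (val b)^-1)%g, b); last by rewrite /e /= mulgVK.
    rewrite mem_filter /e /= -xb eqxx /=; apply/allpairsP.
    exists ((x * (val b)^-1)%g, b); split=> //=; last exact: mem_index_enum.
    by rewrite mem_sphere -eqSS -l xN.
  rewrite mem_filter => /andP[/eqP yb /allpairsP[[y' b'] /= [yN _ [ey eb]]] ->].
  by move: yN; rewrite yb -ey /= mem_sphere => /eqP ->.
rewrite big_filter big_mkcond big_allpairs_dep /=; apply: eq_bigr => x _.
by rewrite [RHS]big_mkcond.
Qed.

Lemma startset_extE a x b : (0 < wlen A x)%N -> ext x b ->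
  `[< startset a (x * val b)%g >] = `[< startset a x >].
Proof.
move=> x0 xb; apply/asboolP/asboolP => [h|h]; last exact: startset_ext.
have [|c cx] := @startset_ex _ A x.
  by apply: contraTneq x0 => ->; rewrite wlen1.
by rewrite (startset_inj h (startset_ext cx xb)).
Qed.

Lemma sum_sphere_cond N W (Q : pred G) :
  (forall x b, wlen A x = N -> ext x b -> Q (x * val b)%g = Q x) ->
  (forall x, wlen A x = N -> W x =
    \sum_(b : letters A | wlen A (x * val b)%g == (wlen A x).+1) W (x * val b)%g) ->
  \sum_(x <- sphere N.+1 | Q x) W x = \sum_(x <- sphere N | Q x) W x.
Proof.
move=> QE WE; rewrite big_mkcond sum_sphereS [RHS]big_mkcond.
rewrite big_seq [RHS]big_seq; apply: eq_bigr => x; rewrite mem_sphere => /eqP xN.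
case: ifPn => Qx; first rewrite WE//; last first.
  by rewrite big1// => b /eqP xb; rewrite QE// (negbTE Qx).
by apply: eq_bigr => b /eqP xb; rewrite QE// Qx.
Qed.

(** Prepending c is a bijection from the words of length N not starting with [c^-1] onto the words
    of length N+1 starting with c. *)
Lemma sum_sphere_shift N W c :
  \sum_(x <- sphere N | ~~ `[< startset (letter_inv c) x >]) W (val c * x)%g =
  \sum_(x <- sphere N.+1 | `[< startset c x >]) W x.
Proof.
rewrite -big_filter -(big_map (fun x => (val c * x)%g) xpredT) -[RHS]big_filter.
apply: perm_big; apply: uniq_perm.
- by rewrite map_inj_uniq ?filter_uniq ?sphere_uniq// => x y /mulgI.
- by rewrite filter_uniq ?sphere_uniq.
move=> x; apply/mapP/idP => [[y]|].
  rewrite !mem_filter !mem_sphere => /andP[/asboolP cy /eqP yN] ->.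
  have cs : startset c (val c * y)%g.
    by apply: contrapT => /startset_compl; rewrite mulKg.
  rewrite asboolT//=; have := rword_startV cs; rewrite mulKg => e.
  by rewrite /wlen e /= -yN.
rewrite mem_filter mem_sphere => /andP[/asboolP cx /eqP xN].
exists ((val c)^-1 * x)%g; last by rewrite mulVKg.
rewrite mem_filter mem_sphere; apply/andP; split.
  by apply/asboolP => /startset_compl; apply.
by have := rword_startV cx; move: xN; rewrite /wlen => + e; rewrite e /= => -[->].
Qed.

(** Left translation by c moves one part of the sphere of radius M to radius M+1 and the rest to
    radius M-1. The splitting rule for W brings both parts back to radius M. *)
Lemma sum_sphere_translate_letter N W c :
  (forall x, (N < wlen A x)%N -> W x =
    \sum_(b : letters A | wlen A (x * val b)%g == (wlen A x).+1) W (x * val b)%g) ->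
  forall M, (N.+1 < M)%N ->
  \sum_(x <- sphere M) W (val c * x)%g = \sum_(x <- sphere M) W x.
Proof.
move=> WE [//|M]; rewrite ltnS => NM.
rewrite (bigID (fun x => `[< startset (letter_inv c) x >])) /= sum_sphere_shift.
have := sum_sphere_shift M (fun x => W (val c * x)%g) (letter_inv c).
rewrite letter_invK => <-.
rewrite [X in X + _](eq_bigr W); last by move=> x _; rewrite val_letter_inv mulVKg.
rewrite [RHS](bigID (fun x => `[< startset c x >])) /= addrC; congr (_ + _).
  apply: sum_sphere_cond => [x b xM|x xM]; last by apply: WE; rewrite xM ltnS ltnW.
  by apply: startset_extE; rewrite xM.
rewrite sum_sphere_cond// => [x b xM xb|x xM]; last by apply: WE; rewrite xM.
by rewrite startset_extE// xM (leq_trans _ NM).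
Qed.

Lemma sum_sphere_translate N W z :
  (forall x, (N < wlen A x)%N -> W x =
    \sum_(b : letters A | wlen A (x * val b)%g == (wlen A x).+1) W (x * val b)%g) ->
  exists N', forall M, (N' < M)%N ->
  \sum_(x <- sphere M) W (z * x)%g = \sum_(x <- sphere M) W x.
Proof.
move=> WE; elim/(@ext_ind _ A): z => [|z c _ [N' ih]].
  by exists 0%N => M _; apply: eq_bigr => x _; rewrite mul1g.
(* The function [W (z * _)] obeys the splitting rule only beyond length N + |z|, since z may cancel
   |z| letters of its argument. *)
exists (maxn N'.+1 (N + (wlen A z)).+2)%N => M; rewrite gtn_max => /andP[M1 M2].
rewrite -ih; last exact: ltnW.
under eq_bigr do rewrite -mulgA.
apply: (@sum_sphere_translate_letter (N + wlen A z)%N (fun x => W (z * x)%g));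
  last exact: ltnW.
move=> x xN.
have zx : (wlen A z < wlen A x)%N by apply: leq_trans xN; rewrite ltnS leq_addl.
have [a ax] : exists a, endset a x by apply: endset_ex; exact: leq_ltn_trans zx.
have [azx l] := translate_endset zx ax.
rewrite WE; last first.
  by rewrite -(ltn_add2l (wlen A z)) (leq_trans _ l)// addnC.
apply: eq_big => b; last by rewrite mulgA.
apply/eqP/eqP => h; first by apply/(extP _ ax)/(extP _ azx).
by apply/(extP _ azx)/(extP _ ax).
Qed.

End Spheres.

(** * Linear spans in a Hilbert space *)

Section Spans.
Variables (R : realType) (H : hilbertType R).
Implicit Types (S T M : set H) (u v w : H) (s o : seq H).

Definition lspan S : set H := [set v | forall M, linear_subspace M -> S `<=` M -> M v].

Lemma sub_lspan S : S `<=` lspan S.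
Proof. by move=> v Sv M _; apply. Qed.

Lemma lspan_subspace S : linear_subspace (lspan S).
Proof.
split=> [M [] //|c u v Su Sv M MM SM].
by apply: MM.2; [exact: Su|exact: Sv].
Qed.

Lemma lspan_min S M : linear_subspace M -> S `<=` M -> lspan S `<=` M.
Proof. by move=> MM SM v; apply. Qed.

Lemma lspan_sub S T : S `<=` lspan T -> lspan S `<=` lspan T.
Proof. by move=> ST; apply: lspan_min => //; exact: lspan_subspace. Qed.

Lemma lspanS S T : S `<=` T -> lspan S `<=` lspan T.
Proof. by move=> ST; apply: lspan_sub => v /ST /sub_lspan. Qed.

Lemma lspanZ S c u : lspan S u -> lspan S (c *: u).
Proof. by move=> Su M MM SM; rewrite -[_ *: _]addr0; apply: MM.2; [exact: Su|case: MM]. Qed.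

Lemma lspanD S u v : lspan S u -> lspan S v -> lspan S (u + v).
Proof. by move=> Su Sv; rewrite -[u]scale1r; exact: (lspan_subspace S).2. Qed.

Lemma lspanB S u v : lspan S u -> lspan S v -> lspan S (u - v).
Proof. by move=> Su Sv; rewrite addrC -scaleN1r; exact: (lspan_subspace S).2. Qed.

Lemma lspan_sum (I : eqType) (r : seq I) (P : pred I) (F : I -> H) S :
  (forall i, i \in r -> P i -> lspan S (F i)) -> lspan S (\sum_(i <- r | P i) F i).
Proof.
move=> SF; rewrite big_seq_cond; elim/big_ind: _ => [||i /andP[ir Pi]].
- by case: (lspan_subspace S).
- by move=> u v; exact: lspanD.
- exact: SF.
Qed.

Lemma subspace_orthl w : linear_subspace [set v | dotp v w = 0].
Proof.
split=> [|c u v] /=; first by rewrite linear0l.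
by move=> uw vw; rewrite linearPl/= uw vw mulr0 addr0.
Qed.

Lemma dotp_conj u v : dotp u v = Num.conj (dotp v u).
Proof. by rewrite hermC expr0 mul1r. Qed.

Lemma dotp0C u v : dotp u v = 0 -> dotp v u = 0.
Proof. by move=> uv; rewrite dotp_conj uv rmorph0. Qed.

Lemma lspan_orth S T : (forall u v, S u -> T v -> dotp u v = 0) ->
  forall u v, lspan S u -> lspan T v -> dotp u v = 0.
Proof.
move=> ST u v Su Tv; apply: (lspan_min (subspace_orthl v) _ Su) => {}u {}Su /=.
apply: dotp0C; apply: (lspan_min (subspace_orthl u) _ Tv) => {}v {}Tv /=.
exact/dotp0C/ST.
Qed.

Definition orthonormal_seq s :=
  forall i j, (i < size s)%N -> (j < size s)%N -> dotp s`_i s`_j = (i == j)%:R.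

Lemma orthonormal_proj s v : orthonormal_seq s -> lspan [set` s] v ->
  v = \sum_(i < size s) dotp v s`_i *: s`_i.
Proof.
move=> os; pose Pr v := \sum_(i < size s) dotp v s`_i *: s`_i.
suff : lspan [set` s] `<=` [set v | v = Pr v] by move=> h /h.
apply: lspan_min; first split=> /=.
- by rewrite /Pr big1// => i _; rewrite linear0l scale0r.
- move=> c u w /= eu ew; rewrite {1}eu {1}ew /Pr scaler_sumr -big_split /=.
  by apply: eq_bigr => i _; rewrite linearPl/= scalerDl scalerA.
move=> u /= us; have := us; rewrite -index_mem => iu.
rewrite -(nth_index 0 us) /Pr (bigD1 (Ordinal iu)) //= os// eqxx scale1r.
rewrite big1 ?addr0// => j ji; rewrite os// (_ : _ == _ = false) ?scale0r//.
by apply/negbTE; apply: contraNneq ji => e; apply/eqP/val_inj.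
Qed.

(** A vector lying in the span of the later ones is dropped, so that s may be any list. *)
Lemma gram_schmidt s : exists o, orthonormal_seq o /\ lspan [set` o] = lspan [set` s].
Proof.
elim: s => [|v s [o [oo os]]]; first by exists [::].
pose u := v - \sum_(i < size o) dotp v o`_i *: o`_i.
have uo j : (j < size o)%N -> dotp u o`_j = 0.
  move=> jo; rewrite linearBl/= linear_sumlz/= (bigD1 (Ordinal jo)) //=.
  rewrite linearZl_LR/= oo// eqxx mulr1 big1 ?addr0 ?subrr// => i ij.
  rewrite linearZl_LR/= oo// (_ : _ == _ = false) ?mulr0//.
  by apply/negbTE; apply: contraNneq ij => e; apply/eqP/val_inj.
have sumS t : {subset o <= t} ->
    lspan [set` t] (\sum_(i < size o) dotp v o`_i *: o`_i).
  move=> ot; apply: lspan_sum.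
  move=> i _ _; apply: lspanZ.
  apply: sub_lspan; exact/ot/mem_nth.
have sv : lspan [set` s] `<=` lspan [set` v :: s].
  by apply: lspanS => w /= ws; rewrite inE ws orbT.
have us : lspan [set` v :: s] u.
  apply: lspanB.
    by apply: sub_lspan; rewrite /= mem_head.
  by apply: sv; rewrite -os; exact: sumS.
have [u0|u0] := eqVneq u 0.
  exists o; split=> //; apply/seteqP; split; first by rewrite os.
  apply: lspan_sub => w; rewrite /= inE => /predU1P[->|ws].
    by move/eqP: u0; rewrite subr_eq0 => /eqP ->; exact: sumS.
  by rewrite os; exact: sub_lspan.
have uu : 0 < dotp u u by rewrite dnorm_gt0.
pose k := (sqrtC (dotp u u))^-1; have k0 : 0 < k by rewrite invr_gt0 sqrtC_gt0.
exists (k *: u :: o); split.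
  have ku j : (j < size o)%N -> dotp (k *: u) o`_j = 0.
    by move=> jo; rewrite linearZl_LR/= uo// mulr0.
  move=> [|i] [|j] //= io jo.
  - by rewrite dnormZ /= (gtr0_norm k0) exprVn sqrtCK mulVf ?gt_eqF.
  - exact: ku.
  - by apply/dotp0C/ku.
  - by rewrite oo.
apply/seteqP; split; apply: lspan_sub => w; rewrite /= inE => /predU1P[->|wo].
- exact: lspanZ.
- by apply: sv; rewrite -os; exact: sub_lspan.
- have -> : v = u + \sum_(i < size o) dotp v o`_i *: o`_i by rewrite subrK.
  apply: lspanD; last first.
    by apply: sumS => x xo; rewrite inE xo orbT.
  have : lspan [set` k *: u :: o] (k^-1 *: (k *: u)).
    by apply: lspanZ; apply: sub_lspan; rewrite /= mem_head.
  by rewrite scalerA mulVf ?lt0r_neq0// scale1r.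
- have : lspan [set` o] w by rewrite os; exact: sub_lspan.
  by apply: lspanS => x /= xo; rewrite inE xo orbT.
Qed.

(** Row vectors are coordinates on the span of s. For an orthonormal s they identify the span with a
    standard Hermitian space, which will serve as V_a. *)
Definition comb s (v : 'rV[R[i]]_(size s)) : H := \sum_(i < size s) v 0 i *: s`_i.

Lemma comb_linear s : linear (@comb s).
Proof.
move=> c x y; rewrite /comb scaler_sumr -big_split /=; apply: eq_bigr => i _.
by rewrite !mxE scalerDl scalerA.
Qed.
HB.instance Definition _ s := GRing.isLinear.Build R[i] 'rV[R[i]]_(size s) H
  *:%R (@comb s) (@comb_linear s).

Lemma comb_span s x : lspan [set` s] (@comb s x).
Proof.
apply: lspan_sum => i _ _.
apply: lspanZ.
by apply: sub_lspan; exact: mem_nth.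
Qed.

Lemma comb_dotp s x y : orthonormal_seq s -> dotp (@comb s x) (@comb s y) = dotmx x y.
Proof.
move=> os; rewrite dotmxE mxE /comb linear_sumlz/=; apply: eq_bigr => i _.
rewrite linearZl_LR/= linear_sumr/= (bigD1 i)//= linearZr_LR/= os// eqxx mulr1.
rewrite big1 ?addr0 ?mxE// => j ji; rewrite linearZr_LR/= os// eq_sym.
by rewrite (_ : _ == _ = false) ?mulr0//; apply/negbTE.
Qed.

Definition coords s v : 'rV[R[i]]_(size s) := \row_i dotp v s`_i.

Lemma coordsK s v : orthonormal_seq s -> lspan [set` s] v -> comb (coords s v) = v.
Proof.
move=> os sv; rewrite [RHS](orthonormal_proj os sv).
by apply: eq_bigr => i _; rewrite mxE.
Qed.

End Spans.

Lemma lspan_linear (R : realType) (H K : hilbertType R) (L : {linear H -> K})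
    (S : set H) (T : set K) v :
  (forall s, S s -> lspan T (L s)) -> lspan S v -> lspan T (L v).
Proof.
move=> ST Sv; apply: (Sv (L @^-1` lspan T)) => //.
split=> [|c u w Tu Tw] /=; rewrite ?linear0 ?linearP.
  by case: (lspan_subspace T).
exact: (lspan_subspace T).2.
Qed.

(** * Multiplicative functions supported on a cone *)

Section Eventually.
Variables (G : groupType) (A : free_generators G).
Implicit Types (a b e : letters A) (x y z u : G).

Lemma finite_eventually (Q : set G) : finite_set Q -> eventually_long A (fun x => ~ Q x).
Proof.
move=> /finite_seqP[s ->]; elim: s => [|g s [N h]]; first by exists 0%N.
exists (maxn N (wlen A g).+1) => x; rewrite geq_max => /andP[Nx gx] /=.
rewrite inE => /predU1P[xg|]; last exact: h.
by rewrite xg ltnn in gx.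
Qed.

Lemma endset_cat u a z e : ext u a -> startset a z -> endset e z -> endset e (u * z)%g.
Proof.
by move=> ua az [w ew]; exists (rword A u ++ w); rewrite (rword_cat ua az) ew rcons_cat.
Qed.

Lemma ext_cat u a z b : ext u a -> startset a z -> ext (u * z)%g b -> ext z b.
Proof.
move=> ua az uzb; have [|e ez] := @endset_ex _ A z.
  by case: az => w ew; rewrite /wlen ew.
by apply/(extP _ ez); apply/(extP _ (endset_cat ua az ez)).
Qed.

(** The last condition puts y in the cone beyond the edge from [x * a^-1] to x; the witness x is the
    prefix of y of length N. *)
Lemma sphere_prefix_ex N y : (0 < N <= wlen A y)%N -> exists x a,
  [/\ wlen A x = N, endset a x & startset a (val a * x^-1 * y)%g].
Proof.
move=> /andP[N0]; elim/(@ext_ind _ A): y => [|y b yb ih].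
  by rewrite wlen1 leqNgt N0.
rewrite yb leq_eqVlt => /predU1P[->|].
  exists (y * val b)%g, b; split=> //; first exact: endset_ext.
  by rewrite mulgVK; exact: startset_letter.
rewrite ltnS => /ih[x [a [xN ax axy]]]; exists x, a; split=> //.
rewrite mulgA; apply: startset_ext => //.
have [xa _] := endset_split ax; apply: ext_cat xa axy _.
by rewrite -!mulgA mulKg mulVKg.
Qed.

Lemma sphere_prefix_uniq x x' a a' y : wlen A x = wlen A x' -> endset a x -> endset a' x' ->
  startset a (val a * x^-1 * y)%g -> startset a' (val a' * x'^-1 * y)%g -> x = x'.
Proof.
suff h z b : endset b z -> startset b (val b * z^-1 * y)%g ->
    rword A z = take (wlen A z) (rword A y).
  move=> xx' ax ax' /(h _ _ ax) e /(h _ _ ax') e'.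
  have [_ <-] := rwordP A x; have [_ <-] := rwordP A x'.
  by rewrite e e' xx'.
move=> bz sz; have [zb l] := endset_split bz.
have := rword_cat zb sz; rewrite -!mulgA mulKg mulVKg => ->; rewrite mulgA.
case: (sz) => w ew; rewrite ew.
have := rword_ext zb; rewrite mulgVK => ez.
by rewrite ez -cat_rcons take_size_cat// /wlen ez.
Qed.

End Eventually.

Section Germs.
Variables (R : realType) (G : groupType) (A : free_generators G).
Variable X : matrix_system R A.
Implicit Types (a b c : letters A) (x y z : G).

Definition values_steps (u : values X) (w : seq G) : values X :=
  foldl (fun u g => values_step (last_letter A g) u) u w.

(** A function carried by the cone of b: it starts with v at b and is continued along words by the
    maps H. The translates of such functions span H^infty, by [mfun_split]. *)
Definition germ b (v : ms_space X b) x : values X :=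
  if `[< startset b x >] then values_steps (existT _ b v) (behead (rword A x))
  else values_zero X (last_letter A x).

Lemma germ_out b v x : ~ startset b x -> @germ b v x = values_zero X (last_letter A x).
Proof. by move=> bx; rewrite /germ asboolF. Qed.

Lemma germ_letter b v : @germ b v (val b) = existT _ b v.
Proof. by rewrite /germ asboolT ?rword_letter//; exact: startset_letter. Qed.

Lemma germ_ext b v x c : startset b x -> ext x c ->
  @germ b v (x * val c)%g = values_step c (germ v x).
Proof.
move=> bx xc; rewrite /germ !asboolT//; last exact: startset_ext.
rewrite rword_ext//; case: bx => w -> /=.
by rewrite /values_steps foldl_rcons (last_letterP (endset_letter c)).
Qed.

Lemma germ_uniq b v (f : G -> values X) :
  f (val b) = existT _ b v ->
  (forall z c, startset b z -> ext z c -> f (z * val c)%g = values_step c (f z)) ->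
  forall z, startset b z -> f z = germ v z.
Proof.
move=> fb fext; apply: startset_ind => [|x c bx xc ih]; first by rewrite germ_letter.
by rewrite fext// germ_ext// ih.
Qed.

Lemma germ_tag b v x : startset b x -> tag (@germ b v x) = last_letter A x.
Proof.
move: x; apply: startset_ind => [|x c bx xc _].
  by rewrite germ_letter (last_letterP (endset_letter b)).
by rewrite germ_ext// (last_letterP (endset_ext xc)).
Qed.

Lemma germ_step b v x a : endset a x -> tag (@germ b v x) = a /\
  forall c, ext x c -> @germ b v (x * val c)%g = values_step c (germ v x).
Proof.
move=> ax; have [bx|nbx] := pselect (startset b x).
  split=> [|c xc]; last exact: germ_ext.
  by rewrite germ_tag// (last_letterP ax).
rewrite germ_out//; split=> [|c xc]; first by rewrite /= (last_letterP ax).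
have nbxc : ~ startset b (x * val c)%g.
  by move/asboolP; rewrite startset_extE// => [/asboolP//|]; exact: endset_gt0 ax.
rewrite germ_out// (last_letterP (endset_ext xc)) /values_step /values_zero /=.
by rewrite linear0.
Qed.

Lemma germ_multiplicative b v : Defs.multiplicative (@germ b v).
Proof. by exists 1%N => x _ a ax; exact: germ_step. Qed.

Definition Hgerm b (v : ms_space X b) : Hinf X := \pi_(Hinf X) (to_mfun (germ_multiplicative v)).

(** Where the tag of [f x] is not the last letter of x, [tagged_as] falls back on 0. A
    multiplicative function has only finitely many such points. *)
Definition value_at (f : G -> values X) x : ms_space X (last_letter A x) :=
  tagged_as (values_zero X (last_letter A x)) (f x).

Lemma value_atE f x : tag (f x) = last_letter A x ->
  f x = existT _ (last_letter A x) (value_at f x).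
Proof.
rewrite /value_at; case: (f x) => a u /= e.
by move: u; rewrite e => u; rewrite tagged_asE.
Qed.

Lemma value_at_zero f x b : f x = values_zero X b -> value_at f x = 0.
Proof.
rewrite /value_at => ->; have [->|nb] := eqVneq b (last_letter A x).
  by rewrite tagged_asE.
rewrite /tagged_as /=; case: eqP => // e.
by rewrite -e eqxx in nb.
Qed.

Lemma value_at_add f g x : tag (f x) = last_letter A x -> tag (g x) = last_letter A x ->
  value_at (fun y => values_add (f y) (g y)) x = value_at f x + value_at g x.
Proof.
move=> /value_atE fx /value_atE gx.
by rewrite {1}/value_at fx gx values_addE tagged_asE.
Qed.

Lemma value_at_scale k f x : tag (f x) = last_letter A x ->
  value_at (fun y => values_scale k (f y)) x = k *: value_at f x.
Proof.
by move=> /value_atE fx; rewrite {1}/value_at fx /values_scale /= tagged_asE.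
Qed.

(** Describing a class by a dependent function phi turns sums of classes into sums in the fixed
    spaces V_a, with no tags left to compare. *)
Definition has_values (F : Hinf X) (phi : forall x, ms_space X (last_letter A x)) :=
  eventually_long A (fun x => repr F x = existT _ (last_letter A x) (phi x)).

Lemma repr_pi (f : mfun X) : eventually_long A (fun x => repr (\pi_(Hinf X) f) x = f x).
Proof.
apply: eventually_impl (finite_eventually _ (Hinf_repr f)) => x /= h.
exact: contrapT.
Qed.

Lemma has_values_pi (f : mfun X) phi :
  eventually_long A (fun x => f x = existT _ (last_letter A x) (phi x)) ->
  has_values (\pi_(Hinf X) f) phi.
Proof.
move=> h; apply: eventually_impl (eventually_and h (repr_pi f)) => x [fx ->].
exact: fx.
Qed.

Lemma has_values_mfun (f : mfun X) : has_values (\pi_(Hinf X) f) (value_at f).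
Proof.
by apply: has_values_pi; apply: eventually_impl (mfun_tag f) => x /value_atE.
Qed.

Lemma has_values_uniq F F' phi phi' : has_values F phi -> has_values F' phi' ->
  eventually_long A (fun x => phi x = phi' x) -> F = F'.
Proof.
move=> h h' e; rewrite -[F]reprK -[F']reprK; apply: Hinf_eventually.
apply: eventually_impl (eventually_and h (eventually_and h' e)) => x [-> [-> ->]].
by [].
Qed.

Lemma has_values_zero : has_values 0 (fun=> 0).
Proof. by apply: has_values_pi; exists 0%N. Qed.

Lemma has_values_add F F' phi phi' : has_values F phi -> has_values F' phi' ->
  has_values (F + F') (fun x => phi x + phi' x).
Proof.
move=> h h'; apply: has_values_pi.
by apply: eventually_impl (eventually_and h h') => x [e e']; rewrite mfunE e e' values_addE.
Qed.

Lemma has_values_scale k F phi : has_values F phi ->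
  has_values (k *: F) (fun x => k *: phi x).
Proof.
move=> h; apply: has_values_pi.
by apply: eventually_impl h => x e; rewrite mfunE e.
Qed.

Lemma has_values_sum (I : Type) (r : seq I) (P : pred I) (F : I -> Hinf X) phi :
  (forall i, P i -> has_values (F i) (phi i)) ->
  has_values (\sum_(i <- r | P i) F i) (fun x => \sum_(i <- r | P i) phi i x).
Proof.
move=> h; elim: r => [|i r ih].
  rewrite big_nil (_ : (fun x => _) = fun=> 0); first exact: has_values_zero.
  by apply/functional_extensionality_dep => x; rewrite big_nil.
rewrite big_cons (_ : (fun x => _) = fun x => if P i then
    phi i x + \sum_(j <- r | P j) phi j x else \sum_(j <- r | P j) phi j x).
  by case: ifP => // Pi; apply: has_values_add => //; exact: h.
by apply/functional_extensionality_dep => x; rewrite big_cons.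
Qed.

Lemma has_values_Hgerm b v : has_values (@Hgerm b v) (value_at (germ v)).
Proof. exact: has_values_mfun. Qed.

Lemma has_values_translate z (f : mfun X) :
  has_values (Hinf_pi z (\pi_(Hinf X) f)) (value_at (fun x => f (z^-1 * x)%g)).
Proof. by rewrite Hinf_piE; exact: (has_values_mfun (mfun_translate z f)). Qed.

Lemma Hgerm_linear b : linear (@Hgerm b).
Proof.
move=> k u v.
have h := has_values_add (has_values_scale k (has_values_Hgerm u)) (has_values_Hgerm v).
apply: has_values_uniq (has_values_Hgerm _) h _; exists 1%N => x x0.
have [bx|nbx] := pselect (startset b x); last first.
  by rewrite !(value_at_zero (germ_out _ nbx)) scaler0 addr0.
pose g x := values_add (values_scale k (germ u x)) (germ v x).
have gE : g x = germ (k *: u + v) x.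
  apply: (germ_uniq (f := g)) bx => [|z c bz zc].
    by rewrite /g !germ_letter /values_scale/= values_addE.
  rewrite /g !germ_ext//; have := germ_tag u bz; have := germ_tag v bz.
  case: (germ u z) => a u1; case: (germ v z) => a' v1 /= e' e.
  move: u1 v1; rewrite e e' => u1 v1.
  by rewrite /values_step /values_scale /= !values_addE tagged_asE linearP.
rewrite -(value_at_scale k (germ_tag u bx)) -value_at_add ?germ_tag//;
  last by rewrite /= germ_tag.
by rewrite /value_at -gE.
Qed.

HB.instance Definition _ b := GRing.isLinear.Build R[i] (ms_space X b) (Hinf X)
  *:%R (@Hgerm b) (@Hgerm_linear b).

(** The cone of a consists of the word a and of the cones beyond the letters c that may follow; in
    the latter the germ continues with the value H_ca v. *)
Lemma Hgerm_split a (v : ms_space X a) :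
  Hgerm v = \sum_(c | (val a * val c)%g != 1%g) Hinf_pi (val a) (Hgerm (ms_map X c a v)).
Proof.
have h := has_values_sum (index_enum (letters A))
  (P := fun c => (val a * val c)%g != 1%g) (fun c _ =>
  has_values_translate (val a) (to_mfun (germ_multiplicative (ms_map X c a v)))).
(* Length 2 excludes the word a itself, which lies in no cone on the right-hand side. *)
apply: has_values_uniq (has_values_Hgerm _) h _; exists 2%N => x x2 /=.
have out c : ~ startset c ((val a)^-1 * x)%g ->
    value_at (fun y => germ (ms_map X c a v) ((val a)^-1 * y)%g) x = 0.
  move=> cx; apply: (@value_at_zero _ _ (last_letter A ((val a)^-1 * x)%g)).
  exact: germ_out.
have [ax|nax] := pselect (startset a x); last first.
  rewrite (value_at_zero (germ_out _ nax)) big1// => c ac; apply: out => cx.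
  by apply: nax; rewrite -[x](mulVKg (val a)); exact: startset_mull cx.
have [xa|[c [ac cx]]] := startset_step ax.
  by move: x2; rewrite xa wlen_letter.
rewrite (bigD1 c)//= big1 ?addr0 => [|d /andP[ad dc]]; last first.
  by apply: out => dx; rewrite (startset_inj dx cx) eqxx in dc.
suff e : germ v x = germ (ms_map X c a v) ((val a)^-1 * x)%g by rewrite /value_at e.
have ext_ac : ext (val a) c by apply/(extP _ (endset_letter a)).
have := @germ_uniq c (ms_map X c a v) (fun z => germ v (val a * z)%g).
move=> /(_ _ _ _ cx); rewrite mulVKg; apply.
  rewrite germ_ext ?germ_letter//; exact: startset_letter.
move=> z d cz zd; rewrite mulgA germ_ext//; first exact: startset_mull cz.
exact: ext_startset cz zd.
Qed.

(** Far out, f is determined by its values on one large sphere, and each value is continued inside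
    the cone beyond its own point. *)
Lemma mfun_split (f : mfun X) : exists N, (0 < N)%N /\
  (\pi_(Hinf X) f : Hinf X) = \sum_(x <- sphere A N)
    Hinf_pi (x * (val (last_letter A x))^-1)%g (Hgerm (value_at f x)).
Proof.
(* The radius is made positive so that every point of the sphere has a last letter. *)
have [N0 fm] := mfunP f; pose N := N0.+1; exists N; split=> //.
pose g x y := germ (value_at f x) (val (last_letter A x) * x^-1 * y)%g.
have gT x : has_values (Hinf_pi (x * (val (last_letter A x))^-1)%g
    (Hgerm (value_at f x))) (value_at (g x)).
  have := has_values_translate (x * (val (last_letter A x))^-1)%g
    (to_mfun (germ_multiplicative (value_at f x))).
  by rewrite /mfun_apply/= invgM invgK.
have h := has_values_sum (sphere A N) (P := xpredT) (fun x _ => gT x).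
apply: has_values_uniq (has_values_mfun _) h _; exists N => y Ny.
have [|x [a [xN ax axy]]] := @sphere_prefix_ex _ A N y; first exact: Ny.
have xs : x \in sphere A N by rewrite mem_sphere xN.
rewrite (bigD1_seq x) ?sphere_uniq//= big_seq_cond big1 ?addr0; last first.
  move=> x' /andP[]; rewrite mem_sphere => /eqP x'N x'x.
  apply: (@value_at_zero _ _ (last_letter A (val (last_letter A x') * x'^-1 * y)%g)).
  apply: germ_out => sx'.
  have [|a' ax'] := @endset_ex _ A x'; first by rewrite x'N.
  rewrite (last_letterP ax') in sx'.
  have := sphere_prefix_uniq _ ax' ax sx' axy; rewrite x'N xN => /(_ erefl) e.
  by rewrite e eqxx in x'x.
suff e : f y = g x y by rewrite /value_at e.
rewrite /g; have xa := last_letterP ax; rewrite -xa in ax axy.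
have [xb xl] := endset_split ax.
set l := last_letter A x in ax axy xb *.
have := germ_uniq (v := value_at f x) (f := fun z => f (x * (val l)^-1 * z)%g) _ _ axy.
rewrite -!mulgA mulKg mulVKg mulgA => -> //.
  rewrite mulgVK; apply: value_atE.
  by have [] := fm x _ _ ax; rewrite // xN.
move=> z c lz zc; have pz := wlen_cat xb lz.
have pN : (N0 <= wlen A (x * (val l)^-1 * z)%g)%N.
  rewrite pz; have : N = (wlen A (x * (val l)^-1)%g).+1 by rewrite -xN xl.
  by case=> ->; exact: leq_addr.
have [|e pe] := @endset_ex _ A (x * (val l)^-1 * z)%g.
  by rewrite pz; case: lz => w; rewrite /wlen => ->; rewrite addnS.
rewrite [(_ * (z * _))%g]mulgA.
by apply: (fm _ pN e pe).2; rewrite -/(ext _ _); exact: ext_startset lz zc.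
Qed.

End Germs.

Section InnerProducts.
Variables (R : realType) (G : groupType) (A : free_generators G).
Variable X : matrix_system_ip R A.
Implicit Types (a b c : letters A) (x y z : G) (f g : G -> values X).

Lemma values_formE a (u v : ms_space X a) :
  values_form (existT _ a u : values X) (existT _ a v) = msip_form X a u v.
Proof. by rewrite /values_form tagged_asE. Qed.

Lemma sphere_sumE N f g :
  sphere_sum N f g = \sum_(x <- sphere A N.+1) values_form (f x) (g x).
Proof. by rewrite sum_sphereS /sphere_sum fsbig_finite//; exact: finite_sphere. Qed.

Lemma Hinf_dotpE (F F' : Hinf X) k :
  (exists N0, forall N, (N0 <= N)%N -> sphere_sum N (repr F) (repr F') = k) ->
  Hinf_dotp F F' = k.
Proof.
move=> hk; rewrite /Hinf_dotp; case: xgetP => [d _ [N hN]|/(_ k)//].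
case: hk => M hM; rewrite -(hN (maxn N M)) ?leq_maxl//.
by rewrite hM// leq_maxr.
Qed.

Lemma Hinf_dotp_disjoint (F F' : Hinf X) phi phi' :
  has_values F phi -> has_values F' phi' ->
  eventually_long A (fun x => phi x = 0 \/ phi' x = 0) -> Hinf_dotp F F' = 0.
Proof.
move=> h h' d; have [N0 hN] := eventually_and h (eventually_and h' d).
apply: Hinf_dotpE; exists N0 => N NN; rewrite sphere_sumE big_seq big1// => x.
rewrite mem_sphere => /eqP xN; have [|-> [-> pp]] := hN x.
  by rewrite xN (leq_trans NN).
rewrite values_formE; case: pp => ->; first by rewrite linear0l.
by rewrite linear0r.
Qed.

(** Germs carried by disjoint cones have disjoint supports, so every term of the sphere sums
    vanishes. *)
Lemma Hgerm_orth a b (u : ms_space X a) (v : ms_space X b) x y :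
  (forall z, startset a (x^-1 * z)%g -> ~ startset b (y^-1 * z)%g) ->
  Hinf_dotp (Hinf_pi x (Hgerm u)) (Hinf_pi y (Hgerm v)) = 0.
Proof.
move=> d; apply: Hinf_dotp_disjoint; try exact: has_values_translate.
exists 0%N => z _; have [az|naz] := pselect (startset a (x^-1 * z)%g).
  right; apply: (@value_at_zero _ _ _ _ _ _ (last_letter A (y^-1 * z)%g)).
  by apply: germ_out; exact: d.
left; apply: (@value_at_zero _ _ _ _ _ _ (last_letter A (x^-1 * z)%g)).
exact: germ_out.
Qed.

End InnerProducts.

(** * Families of subspaces indexed by letters *)

Section Families.
Variables (R : realType) (G : groupType) (H : hilbertType R).
Variables (rho : unitary_rep G H) (A : free_generators G).
Implicit Types (a b c : letters A) (x y z : G) (S : letters A -> seq H).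

Definition cone x a : set G := [set z | startset a (x^-1 * z)%g].

Definition successor_vectors S a : set H :=
  [set v | exists b t, [/\ (val a * val b)%g != 1%g, t \in S b & v = rho (val a) t]].

Definition orbit_vectors S : set H :=
  [set v | exists x b t, t \in S b /\ v = rho x t].

(* The span of [rho x (S a)] stands for the vectors carried by the ends of the
   tree beyond the edge from [x] to [x * a]. *)
Record cone_family S : Prop := ConeFamily {
  family_split : forall a s, s \in S a -> lspan (successor_vectors S a) s;
  family_orth : forall x a y b, cone x a `&` cone y b = set0 ->
    forall s t, s \in S a -> t \in S b -> dotp (rho x s) (rho y t) = 0;
  family_dense : dense (lspan (orbit_vectors S)) }.

End Families.

Section MultFamily.
Variables (R : realType) (G : groupType) (H : hilbertType R) (rho : unitary_rep G H).

(** The completion, the dense subspace and the unitary operator amount to one isometric embedding of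
    H^infty with dense range. For the converse, H itself is the completion and the operator is the
    identity. *)
Lemma Mult_embedding : Mult rho <->
  exists (A : free_generators G) (X : matrix_system_ip R A) (j : Hinf X -> H),
    [/\ linear j, forall F F', dotp (j F) (j F') = Hinf_dotp F F',
      dense (range j) & forall x F, rho x (j F) = j (Hinf_pi x F)].
Proof.
split.
  move=> [A [X [K [M [U [MM Md [[V UK VK] Uiso] UM Ueq]]]]]].
  pose j F := V (completion_embed K F); exists A, X, j.
  have jM F : M (j F).
    have : range (completion_embed K) (completion_embed K F) by exists F.
    by rewrite -UM => -[m Mm e]; rewrite /j -e UK.
  split.
  - by move=> c u v; rewrite /j linearP -[RHS]UK linearP !VK.
  - by move=> F F'; rewrite -Uiso !VK completion_isometry.
  - rewrite (_ : range j = M)//; apply/seteqP; split=> [_ [F _ <-]//|m Mm].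
    have : (U @` M) (U m) by exists m.
    by rewrite UM => -[F _ e]; exists F => //; rewrite /j e UK.
  - move=> x F; rewrite -[LHS]UK; congr (V _).
    by apply: Ueq => //; rewrite VK.
move=> [A [X [j [jl jiso jd jeq]]]].
pose jL : {linear Hinf X -> H} := HB.pack j (GRing.isLinear.Build _ _ _ _ j jl).
pose K := @HilbertCompletion R (Hinf X) (@Hinf_dotp R G A X) H jL jiso jd.
exists A, X, K, (range j), (idfun : {linear H -> K}).
split=> //.
- split; first by exists 0 => //; exact: (linear0 jL).
  by move=> c _ _ [F _ <-] [F' _ <-]; exists (c *: F + F'); rewrite ?jl.
- by rewrite image_id.
- by move=> x m F _ /= ->; exact: jeq.
Qed.

(** [S a] is the image of a basis of V_a under germs at a. The three conditions come from
    [Hgerm_split], [Hgerm_orth] and [mfun_split]. *)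
Lemma Mult_cone_family : Mult rho ->
  exists (A : free_generators G) (S : letters A -> seq H), cone_family rho S.
Proof.
move=> /Mult_embedding[A [X [j [jl jiso jd jeq]]]].
pose jL : {linear Hinf X -> H} := HB.pack j (GRing.isLinear.Build _ _ _ _ j jl).
pose S a : seq H := [seq jL (Hgerm e) | e <- vbasis {: ms_space X a}].
have spanS a (v : ms_space X a) : lspan [set` S a] (jL (Hgerm v)).
  rewrite (coord_vbasis (memvf v)) !linear_sum.
  apply: lspan_sum => i _ _; rewrite !linearZ_LR; apply: lspanZ; apply: sub_lspan.
  by apply: map_f; rewrite -tnth_nth; exact: mem_tnth.
exists A, S; split.
- move=> a _ /mapP[e _ ->]; rewrite Hgerm_split linear_sum.
  apply: lspan_sum => c _ ac /=; rewrite -jeq.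
  apply: (@lspan_linear _ _ _ (rho (val a)) [set` S c]) (spanS c _) => s sc.
  by apply: sub_lspan; exists c, s.
- move=> x a y b d s t /mapP[u _ ->] /mapP[v _ ->] /=.
  rewrite !jeq jiso; apply: Hgerm_orth => z az bz.
  by have : (cone x a `&` cone y b) z by []; rewrite d.
- move=> O O0 oO; have [v [Ov [F _ jF]]] := jd O O0 oO; exists v; split=> //.
  rewrite -jF; move: F {jF}; elim/Hinf_ind=> f; have [N [N0 ->]] := mfun_split f.
  rewrite -[j _]/(jL _) linear_sum; apply: lspan_sum => x _ _ /=; rewrite -jeq.
  apply: (@lspan_linear _ _ _ (rho _) [set` S (last_letter A x)]) (spanS _ _) => s sx.
  by apply: sub_lspan; do 3!eexists; split; first exact: sx.
Qed.

End MultFamily.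

Lemma pythagoras (R : realType) (H : hilbertType R) (I : eqType) (r : seq I)
    (F F' : I -> H) : uniq r ->
  (forall i j, i \in r -> j \in r -> i != j -> dotp (F i) (F' j) = 0) ->
  dotp (\sum_(i <- r) F i) (\sum_(i <- r) F' i) = \sum_(i <- r) dotp (F i) (F' i).
Proof.
move=> ur orth; rewrite linear_sumlz /= [LHS]big_seq [RHS]big_seq.
apply: eq_bigr => i ir; rewrite linear_sumr (bigD1_seq i) //= big_seq_cond.
by rewrite big1 ?addr0// => j /andP[jr ji]; apply: orth; rewrite // eq_sym.
Qed.

(** * The matrix system of an orthonormal family *)

Section OrthonormalFamily.
Variables (R : realType) (G : groupType) (H : hilbertType R).
Variables (rho : unitary_rep G H) (A : free_generators G) (O : letters A -> seq H).
Hypothesis O_on : forall a, orthonormal_seq (O a).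
Hypothesis O_family : cone_family rho O.
Implicit Types (a b c : letters A) (x y z : G).

Let space a : vectType R[i] := 'rV[R[i]]_(size (O a)).

(** H_ba moves the vector back by a^-1 and projects it orthogonally to the span of [O b]. *)
Definition step_fun b a (v : 'rV[R[i]]_(size (O a))) : 'rV[R[i]]_(size (O b)) :=
  coords (O b) (rho (val a)^-1%g (comb v)).

Lemma step_fun_linear b a : linear (@step_fun b a).
Proof.
by move=> k u v; apply/rowP => i; rewrite !mxE linearP linearP linearPl /=.
Qed.
HB.instance Definition _ b a := GRing.isLinear.Build R[i] 'rV[R[i]]_(size (O a))
  'rV[R[i]]_(size (O b)) *:%R (@step_fun b a) (@step_fun_linear b a).

Definition step_map b a : 'Hom(space a, space b) :=
  if (val a * val b == 1)%g then 0 else linfun (@step_fun b a).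

Lemma step_map0 a b : (val a * val b)%g = 1%g -> step_map b a = 0.
Proof. by rewrite /step_map => ->; rewrite eqxx. Qed.

Definition family_system : matrix_system R A := MatrixSystem step_map0.

Lemma repKV x v : rho x (rho x^-1%g v) = v.
Proof. by rewrite -repM mulgV rep1. Qed.

Lemma repK x v : rho x^-1%g (rho x v) = v.
Proof. by rewrite -repM mulVg rep1. Qed.

Lemma cone_letter_disjoint a b x : a != b -> cone x a `&` cone x b = set0.
Proof.
move=> ab; apply/seteqP; split=> // z [az bz].
by rewrite (startset_inj az bz) eqxx in ab.
Qed.

(** By [family_split], the vector moved back by a^-1 lies in the sum of the spans of the admissible
    [O b]. These are pairwise orthogonal, so the sum Q of the projections to them is the identity
    there. *)
Lemma comb_step a (v : space a) :
  comb v = \sum_(b | (val a * val b)%g != 1%g) rho (val a) (comb (step_map b a v)).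
Proof.
pose Q (w : H) := \sum_(b | (val a * val b)%g != 1%g) comb (coords (O b) w).
have Qlin : linear Q.
  move=> k u w; rewrite /Q scaler_sumr -big_split; apply: eq_bigr => b _ /=.
  rewrite -linearP; congr comb; apply/rowP => i.
  by rewrite !mxE linearPl.
pose T := [set t | exists2 b, (val a * val b)%g != 1%g & t \in O b].
have Tv : lspan T (rho (val a)^-1%g (comb v)).
  apply: (@lspan_linear _ _ _ (rho _) [set` O a]) (comb_span v) => s sa.
  have := family_split O_family sa; apply: lspan_linear => _ [b [t [ab tb ->]]].
  by rewrite repK; apply: sub_lspan; exists b.
have QT : lspan T `<=` [set w | Q w = w].
  apply: lspan_min; first split=> /=.
  - by have := Qlin (-1) 0 0; rewrite scaler0 addr0 scaleN1r addNr.
  - by move=> k u w eu ew; rewrite Qlin eu ew.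
  move=> t [b ab tb] /=; rewrite /Q (bigD1 b)//= coordsK//; last exact: sub_lspan.
  rewrite big1 ?addr0// => c /andP[ac cb].
  rewrite (_ : coords (O c) t = 0) ?linear0//; apply/rowP => i; rewrite !mxE.
  rewrite -[t](rep1 rho) -[(O c)`_i](rep1 rho).
  apply: (family_orth O_family _ tb); last exact: mem_nth.
  by apply: cone_letter_disjoint; rewrite eq_sym.
rewrite -[LHS](repKV (val a)) -(QT _ Tv) linear_sum; apply: eq_bigr => b ab.
by rewrite /step_map (negbTE ab) lfunE.
Qed.

Let form a : {dot space a for (@Num.conj R[i])} := @dotmx R[i] (size (O a)).

Lemma form_comb a u v : form a u v = dotp (comb u) (comb v).
Proof. by rewrite comb_dotp. Qed.

(** Pythagoras applied to the decomposition [comb_step]. *)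
Lemma family_compat a (v : space a) :
  form a v v = \sum_b form b (step_map b a v) (step_map b a v).
Proof.
rewrite form_comb {1 2}comb_step big_mkcond /= pythagoras ?index_enum_uniq//.
  apply: eq_bigr => b _; case: ifPn => [ab|/negbNE/eqP ab]; rewrite form_comb.
    by rewrite rep_dotp.
    by rewrite step_map0// zero_lfunE !linear0.
move=> b c _ _ bc; case: ifP => _; last by rewrite linear0l.
case: ifP => _; last by rewrite linear0r.
apply: (@lspan_orth _ _ [set rho (val a) t | t in [set` O b]]
  [set rho (val a) t | t in [set` O c]]).
- move=> _ _ [s sb <-] [t tc <-]; apply: (family_orth O_family _ sb tc).
  exact: cone_letter_disjoint.
- apply: lspan_linear (comb_span _) => s sb; apply: sub_lspan.
  by exists s.
- apply: lspan_linear (comb_span _) => s sb; apply: sub_lspan.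
  by exists s.
Qed.

Definition family_system_ip : matrix_system_ip R A :=
  @MatrixSystemIp R G A family_system form family_compat.

End OrthonormalFamily.

(** * Multiplicative functions as vectors of H *)

Section FamilyEmbedding.
Variables (R : realType) (G : groupType) (H : hilbertType R).
Variables (rho : unitary_rep G H) (A : free_generators G) (O : letters A -> seq H).
Hypothesis O_on : forall a, orthonormal_seq (O a).
Hypothesis O_family : cone_family rho O.
Implicit Types (a b c : letters A) (x y z : G).

Let X : matrix_system_ip R A := family_system_ip O_on O_family.

(** For u in V_a and x ending with a, the value u belongs to the edge arriving at x; that edge
    starts at [x * a^-1], hence the translation. *)
Definition edge_vector x (u : values X) : H :=
  rho (x * (val (tag u))^-1)%g (comb (tagged u : 'rV[R[i]]_(size (O (tag u))))).

Lemma edge_vector_step x b (u : values X) :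
  edge_vector (x * val b)%g (values_step b u) = rho x (comb (step_map rho O b (tag u) (tagged u))).
Proof. by rewrite /edge_vector /= mulgK. Qed.

Lemma edge_vector_split x (u : values X) : endset (tag u) x ->
  edge_vector x u = \sum_(b | wlen A (x * val b)%g == (wlen A x).+1)
    edge_vector (x * val b)%g (values_step b u).
Proof.
case: u => a u /= ax; rewrite {1}/edge_vector /= (comb_step O_on O_family) linear_sum.
apply: eq_big => b.
  by apply/idP/eqP => [ab|/(extP _ ax)//]; exact/(extP _ ax).
by move=> ab; rewrite edge_vector_step -repM mulgVK.
Qed.

(** Two distinct words of equal length are never prefixes of the same word, so the cones beyond them
    are disjoint. *)
Lemma edge_vector_orth x y (u v : values X) : wlen A x = wlen A y -> x != y ->
  endset (tag u) x -> endset (tag v) y -> dotp (edge_vector x u) (edge_vector y v) = 0.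
Proof.
move=> xy nxy ux vy; apply: (@lspan_orth _ _
  [set rho (x * (val (tag u))^-1)%g t | t in [set` O (tag u)]]
  [set rho (y * (val (tag v))^-1)%g t | t in [set` O (tag v)]]).
- move=> _ _ [s su <-] [t tv <-]; apply: (family_orth O_family _ su tv).
  apply/seteqP; split=> // z; rewrite /cone /= !invgM !invgK => -[xz yz].
  by have := sphere_prefix_uniq xy ux vy xz yz => e; rewrite e eqxx in nxy.
- by apply: lspan_linear (comb_span _) => s su; apply: sub_lspan; exists s.
- by apply: lspan_linear (comb_span _) => s su; apply: sub_lspan; exists s.
Qed.

Definition sphere_total N (f : G -> values X) : H := \sum_(x <- sphere A N) edge_vector x (f x).

Definition is_total f v := exists N0, forall N, (N0 <= N)%N -> sphere_total N f = v.

Lemma is_total_uniq f v w : is_total f v -> is_total f w -> v = w.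
Proof.
move=> [N hN] [M hM].
by rewrite -(hN (maxn N M)) ?leq_maxl// hM// leq_maxr.
Qed.

Lemma is_total_eq f g v : eventually_long A (fun x => f x = g x) ->
  is_total f v -> is_total g v.
Proof.
move=> [N e] [M hM]; exists (maxn N M) => K; rewrite geq_max => /andP[NK MK].
rewrite -(hM K MK) /sphere_total big_seq [RHS]big_seq; apply: eq_bigr => x.
by rewrite mem_sphere => /eqP xK; rewrite e// xK.
Qed.

Lemma edge_split (f : G -> values X) x a : endset a x -> tag (f x) = a ->
  (forall b, ext x b -> f (x * val b)%g = values_step b (f x)) ->
  edge_vector x (f x) =
  \sum_(b : letters A | wlen A (x * val b)%g == (wlen A x).+1)
    edge_vector (x * val b)%g (f (x * val b)%g).
Proof.
move=> ax fa fs; rewrite edge_vector_split ?fa//.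
by apply: eq_bigr => b /eqP xb; rewrite fs.
Qed.

Lemma mfun_edge (f : mfun X) : exists N, forall x, (N < wlen A x)%N ->
  endset (tag (f x)) x /\ edge_vector x (f x) =
  \sum_(b : letters A | wlen A (x * val b)%g == (wlen A x).+1)
    edge_vector (x * val b)%g (f (x * val b)%g).
Proof.
have [N h] := mfunP f; exists N => x Nx.
have [|a ax] := @endset_ex _ A x; first exact: leq_ltn_trans Nx.
have [fa fs] := h x (ltnW Nx) a ax.
by split; [rewrite fa|exact: edge_split ax fa fs].
Qed.

(** By [edge_split], passing to the next sphere replaces each edge vector by the sum of its
    successors, so the totals are eventually constant. *)
Lemma is_total_ex (f : mfun X) : exists v, is_total f v.
Proof.
have [N h] := mfun_edge f; exists (sphere_total N.+1 f), N.+1 => M.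
elim: M => // M ih; rewrite leq_eqVlt => /predU1P[<-//|NM].
rewrite -ih// /sphere_total sum_sphereS big_seq [RHS]big_seq.
by apply: eq_bigr => x; rewrite mem_sphere => /eqP xM; rewrite (h x _).2// xM.
Qed.

(** By [is_total_ex] the default 0 is never taken. *)
Definition family_embed (F : Hinf X) : H := xget 0 [set v | is_total (repr F) v].

Lemma family_embed_repr (F : Hinf X) : is_total (repr F) (family_embed F).
Proof.
rewrite /family_embed; case: xgetP => [v -> //|h].
by have [v /h] := is_total_ex (repr F).
Qed.

Lemma family_embedE (f : mfun X) v : is_total f v -> family_embed (\pi_(Hinf X) f) = v.
Proof.
apply: is_total_uniq; apply: is_total_eq (family_embed_repr _).
exact: repr_pi.
Qed.

Lemma family_embed_pi (f : mfun X) : is_total f (family_embed (\pi_(Hinf X) f)).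
Proof. by have [v fv] := is_total_ex f; rewrite (family_embedE fv). Qed.

Lemma edge_vector_linear k a x (u v : ms_space X a) :
  edge_vector x (existT _ a (k *: u + v)) =
  k *: edge_vector x (existT _ a u) + edge_vector x (existT _ a v).
Proof. by rewrite /edge_vector /= !linearP. Qed.

Lemma family_embed_linear : linear family_embed.
Proof.
move=> k; elim/Hinf_ind=> f; elim/Hinf_ind=> g.
have -> : (k *: \pi_(Hinf X) f + \pi_(Hinf X) g : Hinf X) =
    \pi_(Hinf X) (mfun_add (mfun_scale k f) g).
  by rewrite [LHS]Hinf_addrE -[k *: _]/(Hinf_scale k _) Hinf_scaleE Hinf_addE.
apply: family_embedE; have [N hN] := family_embed_pi f.
have [M hM] := family_embed_pi g.
have [L hL] := eventually_and (mfun_large f) (mfun_large g).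
exists (maxn N (maxn M L)) => K; rewrite !geq_max => /and3P[NK MK LK].
rewrite -(hN K NK) -(hM K MK) /sphere_total scaler_sumr -big_split /=.
rewrite big_seq [RHS]big_seq; apply: eq_bigr => x; rewrite mem_sphere => /eqP xK.
have [|[u fx] [v gx]] := hL x; first by rewrite xK.
by rewrite !mfunE fx gx /values_scale /= values_addE edge_vector_linear.
Qed.

Lemma family_embed_dotp F F' : dotp (family_embed F) (family_embed F') = Hinf_dotp F F'.
Proof.
apply/esym/Hinf_dotpE; have [N hN] := family_embed_repr F.
have [M hM] := family_embed_repr F'.
have [L hL] := mfun_edge (repr F); have [L' hL'] := mfun_edge (repr F').
exists (maxn (maxn N M) (maxn L L')) => K; rewrite !geq_max.
move=> /andP[/andP[NK MK] /andP[LK LK']].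
(* [sphere_sum K] evaluates the functions at radius K+1, so the totals are taken there. *)
rewrite -(hN K.+1) ?leqW// -(hM K.+1) ?leqW// sphere_sumE pythagoras ?sphere_uniq//.
  rewrite big_seq [RHS]big_seq; apply: eq_bigr => x; rewrite mem_sphere => /eqP xK.
  have [|ex _] := hL x; first by rewrite xK ltnS.
  have [|ex' _] := hL' x; first by rewrite xK ltnS.
  move: (endset_inj ex ex') => {ex ex'}.
  case: (repr F x) => a u; case: (repr F' x) => b v /= ab.
  move: u v; rewrite ab => u v.
  by rewrite values_formE /edge_vector /= rep_dotp -form_comb.
move=> x y; rewrite !mem_sphere => /eqP xK /eqP yK xy.
apply: edge_vector_orth => //; first by rewrite xK.
  by have [] := hL x; rewrite // xK ltnS.
by have [] := hL' y; rewrite // yK ltnS.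
Qed.

(** The total of a translate is a sum over a translated sphere, and edge vectors obey the splitting
    rule required by [sum_sphere_translate]. *)
Lemma family_embed_equiv z F : rho z (family_embed F) = family_embed (Hinf_pi z F).
Proof.
elim/Hinf_ind: F => f; rewrite Hinf_piE; apply/esym/family_embedE.
have [N hN] := mfun_edge f.
have [N1 h1] := sum_sphere_translate z^-1%g (fun x Nx => (hN x Nx).2).
have [N2 h2] := family_embed_pi f.
exists (maxn N1 N2).+1 => M; rewrite gtn_max => /andP[M1 M2].
rewrite -(h2 M (ltnW M2)) /sphere_total -(h1 M M1) linear_sum.
rewrite big_seq [RHS]big_seq; apply: eq_bigr => x; rewrite mem_sphere => /eqP xM.
by rewrite mfunE /edge_vector -repM !mulgA mulgV mul1g.
Qed.

(** On the sphere of radius 1 only the letter b contributes, and the totals are constant from there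
    on. *)
Lemma family_embed_germ b (v : ms_space X b) : family_embed (Hgerm v) = comb v.
Proof.
apply: family_embedE; exists 1%N.
have h1 : sphere_total 1 (germ v) = comb v.
  rewrite /sphere_total (bigD1_seq (val b)) ?sphere_uniq//=; last first.
    by rewrite mem_sphere wlen_letter.
  rewrite germ_letter {1}/edge_vector /= mulgV rep1 big_seq_cond big1 ?addr0//.
  move=> x /andP[]; rewrite mem_sphere => /eqP x1 xb.
  rewrite germ_out ?/edge_vector /= ?linear0// => bx.
  have := rword_startV bx; move: x1; rewrite /wlen => + e; rewrite e /= => -[/wlen_eq0].
  by move=> /(canRL (mulKg _)); rewrite mulg1 invgK => e'; rewrite e' eqxx in xb.
case=> // N _; elim: N => // N ih.
rewrite -ih /sphere_total sum_sphereS big_seq [RHS]big_seq.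
apply: eq_bigr => x; rewrite mem_sphere => /eqP xN.
have [|a ax] := @endset_ex _ A x; first by rewrite xN.
by have [fa fs] := germ_step v ax; rewrite (edge_split ax fa fs).
Qed.

Lemma orthonormal_family_Mult : Mult rho.
Proof.
apply/Mult_embedding; exists A, X, family_embed; split.
- exact: family_embed_linear.
- exact: family_embed_dotp.
- pose jL : {linear Hinf X -> H} := HB.pack family_embed
    (GRing.isLinear.Build _ _ _ _ family_embed family_embed_linear).
  move=> U U0 oU; have [v [Uv Sv]] := family_dense O_family U0 oU.
  exists v; split=> //; apply: Sv => [|_ [x [b [t [tb ->]]]]].
    split; first by exists 0 => //; exact: (linear0 jL).
    by move=> k _ _ [F _ <-] [F' _ <-]; exists (k *: F + F'); rewrite ?family_embed_linear.
  have tO : lspan [set` O b] t by exact: sub_lspan.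
  exists (Hinf_pi x (Hgerm (coords (O b) t : ms_space X b))) => //.
  by rewrite -family_embed_equiv family_embed_germ coordsK.
- exact: family_embed_equiv.
Qed.

End FamilyEmbedding.

(** The three conditions on the family depend only on the spans of the lists, so each list may be
    replaced by an orthonormal one. *)
Lemma cone_family_Mult (R : realType) (G : groupType) (H : hilbertType R)
    (rho : unitary_rep G H) (A : free_generators G) (S : letters A -> seq H) :
  cone_family rho S -> Mult rho.
Proof.
move=> [Ssplit Sorth Sdense].
have [O hO] := choice (fun a => gram_schmidt (S a)).
have OS a := (hO a).2; apply: (@orthonormal_family_Mult _ _ _ rho A O (fun a => (hO a).1)).
have SO a s : s \in S a -> lspan [set` O a] s by rewrite OS => ?; exact: sub_lspan.
split.
- move=> a s sO; have : lspan [set` S a] s by rewrite -OS; exact: sub_lspan.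
  apply: lspan_sub => {sO}s sS; have := Ssplit a s sS.
  apply: lspan_sub => _ [b [t [ab tb ->]]].
  apply: lspan_linear (SO _ _ tb) => {}t {}tb; apply: sub_lspan.
  by exists b, t.
- move=> x a y b d s t sa tb.
  apply: (@lspan_orth _ _ [set rho x u | u in [set` S a]] [set rho y u | u in [set` S b]]).
  + by move=> _ _ [u ua <-] [v vb <-]; exact: Sorth d _ _ ua vb.
  + apply: (@lspan_linear _ _ _ (rho x) [set` S a]) => [u ua|].
      by apply: sub_lspan; exists u.
    by rewrite -OS; exact: sub_lspan.
  + apply: (@lspan_linear _ _ _ (rho y) [set` S b]) => [u ua|].
      by apply: sub_lspan; exists u.
    by rewrite -OS; exact: sub_lspan.
- move=> U U0 oU; have [v [Uv Sv]] := Sdense U U0 oU; exists v; split=> //.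
  apply: lspan_sub Sv => _ [x [b [t [tb ->]]]].
  apply: lspan_linear (SO _ _ tb) => {}t {}tb; apply: sub_lspan.
  by exists x, b, t.
Qed.

(** * Changing the tree *)

Section Transfer.
Variables (R : realType) (G G1 G2 : groupType).
Variables (A1 : free_generators G1) (A2 : free_generators G2).
(** G1 acts on G from the right through [i1], and G2 from the left through [i2]. Restriction takes
    [i1] the identity, [i2] the inclusion and p the K-part of an element; induction takes [i1] the
    inclusion and both [i2] and p the identity. *)
Variables (i1 : G1 -> G) (i2 : G2 -> G) (p : G -> G2).
Hypothesis i1M : forall x y, i1 (x * y)%g = (i1 x * i1 y)%g.
Hypothesis i2M : forall x y, i2 (x * y)%g = (i2 x * i2 y)%g.
Hypothesis i1_inj : injective i1.
Hypothesis pM : forall z g, p (i2 z * g)%g = (z * p g)%g.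
Hypothesis p_finite : finite_set [set g | p g = 1%g].
Variable reps : set G.
Hypothesis reps_finite : finite_set reps.
Hypothesis repsP : forall g, exists2 r, reps r & exists z, g = (r * i1 z)%g.
(** No orbit y G1 is sent into a single cone; this keeps the maximal edges of a cone at bounded
    distance in each orbit. *)
Hypothesis p_escape : forall y (b : letters A2), exists z, ~ startset b (p (y * i1 z)%g).
Variables (H : hilbertType R) (rho : unitary_rep G2 H) (S : G -> letters A1 -> seq H).

Implicit Types (g y : G) (u z : G1) (x : G2) (a c d : letters A1) (b : letters A2).

Definition source_cone y a : set G := [set g | exists2 z, startset a z & g = (y * i1 z)%g].

Definition target_cone x b : set G := [set g | startset b (x^-1 * p g)%g].

Hypothesis S_split : forall y a v, v \in S y a -> lspan
  [set w | exists c, (val a * val c)%g != 1%g /\ w \in S (y * i1 (val a))%g c] v.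
Hypothesis S_orth : forall y a y' a', source_cone y a `&` source_cone y' a' = set0 ->
  forall v v', v \in S y a -> v' \in S y' a' -> dotp v v' = 0.
Hypothesis S_dense : dense (lspan [set v | exists y a, v \in S y a]).
Hypothesis S_equiv : forall x y a v, v \in S y a -> rho x v \in S (i2 x * y)%g a.

(** The edges [(e.1 * i1 c^-1, c)] are those immediately before e. Source cones grow along
    predecessors, so only the next larger cones are tested. *)
Definition maximal_edges x b : set (G * letters A1) :=
  [set e | source_cone e.1 e.2 `<=` target_cone x b /\
    forall c, (val c * val e.2)%g != 1%g ->
      ~ source_cone (e.1 * i1 (val c)^-1)%g c `<=` target_cone x b].

Lemma i1V z : i1 z^-1%g = (i1 z)^-1%g.
Proof.
have i11 : i1 1%g = 1%g by apply: (@mulgI _ (i1 1%g)); rewrite -i1M !mulg1.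
by apply: (@mulgI _ (i1 z)); rewrite -i1M !mulgV.
Qed.

Lemma i2V x : i2 x^-1%g = (i2 x)^-1%g.
Proof.
have i21 : i2 1%g = 1%g by apply: (@mulgI _ (i2 1%g)); rewrite -i2M !mulg1.
by apply: (@mulgI _ (i2 x)); rewrite -i2M !mulgV.
Qed.

Lemma p_split g : exists t, p t = 1%g /\ g = (i2 (p g) * t)%g.
Proof.
exists (i2 (p g)^-1%g * g)%g; split; first by rewrite pM mulVg.
by rewrite i2V mulVKg.
Qed.

(** By equivariance, the fibre of p over x is the translate by [i2 x] of the fibre over 1, which is
    finite. *)
Lemma finite_preim_p (Q : set G2) : finite_set Q -> finite_set [set g | Q (p g)].
Proof.
move=> Qf; have := finite_image (fun e => (i2 e.1 * e.2)%g) (finite_setX Qf p_finite).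
apply: sub_finite_set => g /= Qg; have [t [pt gt]] := p_split g.
by exists (p g, t).
Qed.

Lemma finite_wlen_bound (K : groupType) (A : free_generators K) (Q : set K) :
  finite_set Q -> exists N, forall h, Q h -> (wlen A h <= N)%N.
Proof.
move=> /finite_eventually -/(_ A)[N hN]; exists N => h Qh.
by rewrite leqNgt; apply/negP => /ltnW /hN.
Qed.

(** Moving g to g s multiplies [p g] on the right by some [p (t * s)] with [p t = 1]. These factors
    have bounded length, so the first letter of [x^-1 * p g] can change only when that word is
    short. *)
Lemma finite_target_boundary x b s :
  finite_set [set g | ~ (target_cone x b g <-> target_cone x b (g * s)%g)].
Proof.
have [N hN] := finite_wlen_bound A2 (finite_image (fun t => p (t * s)%g) p_finite).
have Bf := finite_image (fun h => (x * h)%g) (finite_ball A2 N.+1).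
apply: sub_finite_set (finite_preim_p Bf) => g /= ng.
exists (x^-1 * p g)%g; last by rewrite mulVKg.
rewrite /= ltnNge; apply/negP => Ng; apply: ng.
have [t [pt gt]] := p_split g.
have hs : (wlen A2 (p (t * s)%g) < wlen A2 (x^-1 * p g)%g)%N.
  by apply: leq_ltn_trans Ng; apply: hN; exists t.
have e : p (g * s)%g = (p g * p (t * s)%g)%g by rewrite {1}gt -mulgA pM.
rewrite /target_cone /= e mulgA; split; first exact: startset_mulr.
have [x1|/(@startset_ex _ A2)[c cx]] := eqVneq (x^-1 * p g)%g 1%g.
  by rewrite x1 wlen1 in hs.
by move=> h; rewrite (startset_inj h (startset_mulr hs cx)).
Qed.

Definition boundary (D : set (G2 * letters A2)) : set G :=
  [set g | exists e c, D e /\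
    ~ (target_cone e.1 e.2 g <-> target_cone e.1 e.2 (g * i1 (val c))%g)].

Lemma finite_boundary D : finite_set D -> finite_set (boundary D).
Proof.
move=> Df; apply: (@sub_finite_set _ _ (\bigcup_(e in D) \bigcup_(c in [set: letters A1])
  [set g | ~ (target_cone e.1 e.2 g <-> target_cone e.1 e.2 (g * i1 (val c))%g)])).
  by move=> g [e [c [De h]]]; exists e => //; exists c.
apply: bigcup_finite => // e _; apply: bigcup_finite => [|c _]; first exact: finite_finset.
exact: finite_target_boundary.
Qed.

Lemma eventually_preim (Q : set G) y : finite_set Q ->
  eventually_long A1 (fun u => ~ Q (y * i1 u)%g).
Proof.
move=> Qf; apply: finite_eventually; apply: (finite_preimage _ Qf).
by move=> u z _ _ /mulgI /i1_inj.
Qed.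

(** Every step of a path inside the source cone avoids the boundary, so membership in a cone of D
    never changes along it. *)
Lemma target_cone_const D e y u c z : D e ->
  (forall w, (wlen A1 u < wlen A1 w)%N -> ~ boundary D (y * i1 w)%g) ->
  ext u c -> startset c z ->
  target_cone e.1 e.2 (y * i1 (u * z))%g <-> target_cone e.1 e.2 (y * i1 (u * val c))%g.
Proof.
move=> De hB uc; move: z; apply: startset_ind => // z d cz zd ih.
apply: (iff_trans _ ih); apply: contrapT => h.
apply: (hB (u * z)%g); last first.
  exists e, d; split=> // h'; apply: h; apply: iff_sym.
  by rewrite [(u * (z * _))%g]mulgA (i1M (u * z)%g) mulgA.
rewrite (wlen_cat uc cz) -[ltnLHS]addn0 ltn_add2l.
by case: cz => w; rewrite /wlen => ->.
Qed.

(* The edge is split repeatedly: far from the finite boundary of the cones of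
   [D], each cone [source_cone] meeting their union lies inside one of them. *)
Lemma refine_edge (D : set (G2 * letters A2)) (Q : set G) y a :
  finite_set D -> finite_set Q ->
  source_cone y a `<=` Q `|` [set g | exists2 e, D e & target_cone e.1 e.2 g] ->
  (forall e, D e -> ~ forall z, ~ startset a z -> target_cone e.1 e.2 (y * i1 z)%g) ->
  (forall e, D e -> source_cone y a `<=` target_cone e.1 e.2 ->
    maximal_edges e.1 e.2 (y, a)) ->
  forall v, v \in S y a -> lspan
    [set w | exists e e', [/\ D e, maximal_edges e.1 e.2 e' & w \in S e'.1 e'.2]] v.
Proof.
move=> Df Qf.
have [k1 hk1] := eventually_preim y (finite_boundary Df).
have [k2 hk2] := eventually_preim y Qf.
pose k := maxn k1 k2.
suff h n u c : (k <= wlen A1 u + n)%N -> ext u c ->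
  source_cone (y * i1 u)%g c `<=` Q `|` [set g | exists2 e, D e & target_cone e.1 e.2 g] ->
  (forall e, D e -> ~ forall z, ~ startset c z -> target_cone e.1 e.2 (y * i1 u * i1 z)%g) ->
  (forall e, D e -> source_cone (y * i1 u)%g c `<=` target_cone e.1 e.2 ->
    maximal_edges e.1 e.2 ((y * i1 u)%g, c)) ->
  forall v, v \in S (y * i1 u)%g c -> lspan
    [set w | exists e e', [/\ D e, maximal_edges e.1 e.2 e' & w \in S e'.1 e'.2]] v.
  have := h k 1%g a; have -> : (y * i1 1)%g = y.
    by apply: (@mulIg _ (i1 1%g)); rewrite -mulgA -i1M mulg1.
  by apply; [exact: leq_addl|exact: ext1].
elim: n u c => [|n ih] u c kn uc h1 h2 h3 v vS.
all: have [[e [De ce]]|nD] := pselect (exists e, D e /\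
  source_cone (y * i1 u)%g c `<=` target_cone e.1 e.2);
  first by apply: sub_lspan; exists e, ((y * i1 u)%g, c); split=> //; exact: h3.
  (* At distance k neither Q nor the boundary is met any more: the cone of D that contains the first
     vertex contains the whole source cone. *)
  rewrite addn0 in kn; exfalso; apply: nD.
  have [|QQ|[e De ce]] := h1 (y * i1 (u * val c))%g.
  - by exists (val c); [exact: startset_letter|rewrite i1M mulgA].
  - case: (hk2 (u * val c)%g) => //.
    by rewrite uc (leq_trans (leq_maxr k1 k2))// ltnW.
  exists e; split=> // _ [z cz ->]; rewrite -mulgA -i1M.
  apply/(target_cone_const De _ uc cz) => // w uw; apply: hk1.
  by rewrite (leq_trans (leq_maxl k1 k2))// (leq_trans kn)// ltnW.
have := S_split vS; rewrite -mulgA -i1M.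
apply: lspan_sub => w [d [cd wS]].
have compl z : ~ startset c z -> ~ startset d ((val c)^-1 * z)%g.
  by move=> cz dz; apply: cz; rewrite -[z](mulVKg (val c)); exact: startset_mull dz.
apply: ih wS.
- by rewrite uc addSnnS.
- by apply/(extP _ (endset_ext uc)).
- move=> g [z dz ->]; apply: h1; exists (val c * z)%g; first exact: startset_mull dz.
  by rewrite !i1M !mulgA.
- move=> e De h; apply: (h2 e De) => z /compl /h.
  by rewrite -!mulgA -!i1M -!mulgA mulVKg.
(* The predecessor of the new edge with f = c is the edge just split, which lies in no cone of D.
   The source cone of any other predecessor contains the complement of the split one, which [h2]
   excludes. *)
move=> e De ce; split=> //= f fd fe.
have [fc|fc] := eqVneq f c.
  apply: nD; exists e; split=> //; move: fe.
  by rewrite fc -mulgA -i1M mulgK.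
apply: (h2 e De) => z cz; apply: fe.
exists (val f * ((val c)^-1 * z))%g; last first.
  by rewrite -!mulgA -!i1M -!mulgA mulKg mulVKg.
move/startset_compl: cz; apply: startset_mull.
by rewrite letter_mul_eq1; apply: contra fc => /eqP /(can_inj (@letter_invK _ _)) ->.
Qed.

Lemma target_escape x b y : exists z, ~ target_cone x b (y * i1 z)%g.
Proof.
have [z nz] := p_escape (i2 x^-1 * y)%g b; exists z.
by rewrite /target_cone /= -pM mulgA.
Qed.

(** In each orbit fix a point outside the target cone. The source cone of an edge pointing towards
    this point contains it; an edge pointing away from it and lying beyond the boundary has a
    predecessor inside the same target cone. So maximal edges stay within bounded distance of the
    point. *)
Lemma finite_maximal_edges x b : finite_set (maximal_edges x b).
Proof.
apply: (@sub_finite_set _ _ (\bigcup_(r in reps)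
  [set e | maximal_edges x b e /\ exists u, e.1 = (r * i1 u)%g])).
  move=> e me; have [r rr [u eu]] := repsP e.1.
  by exists r => //; split=> //; exists u.
apply: bigcup_finite => // r _; have [z0 nz0] := target_escape x b r.
have [k hk] := eventually_preim (r * i1 z0)%g (finite_boundary (finite_set1 (x, b))).
have := finite_image (fun e => (r * i1 z0 * i1 e.1, e.2)%g)
  (finite_setX (finite_ball A1 k.+1) (@finite_finset _ [set: letters A1])).
apply: sub_finite_set => -[y a] [[/= ca na] [u0 yu0]].
pose u := (z0^-1 * u0)%g; have yu : y = (r * i1 z0 * i1 u)%g.
  by rewrite yu0 -mulgA -i1M mulVKg.
exists (u, a); last by rewrite yu.
split=> //=; rewrite ltnS leqNgt; apply/negP => ku.
have [|c uc] := @endset_ex _ A1 u; first exact: leq_ltn_trans ku.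
have [extc lu] := endset_split uc; have uV := mulgVK (val c) u.
have [/eqP ca1|ca1] := boolP (val c * val a == 1)%g.
  apply: nz0; apply: ca; exists u^-1%g; last by rewrite yu i1V mulgK.
  apply/startset_endset; rewrite invgK; move/eqP: ca1; rewrite letter_mul_eq1.
  by move/eqP ->; rewrite letter_invK.
apply: (na c ca1) => _ [z cz ->].
have cst := target_cone_const (erefl : [set (x, b)] (x, b)) _ extc.
have hB w : (wlen A1 (u * (val c)^-1)%g < wlen A1 w)%N ->
    ~ boundary [set (x, b)] (r * i1 z0 * i1 w)%g.
  by move=> uw; apply: hk; rewrite (leq_trans _ uw)// -lu ltnW.
have /= e1 := cst _ _ hB cz; have /= e2 := cst _ _ hB (startset_mull ca1 (startset_letter a)).
rewrite yu -mulgA -i1M -mulgA -i1M mulgA; apply/e1/e2/ca.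
exists (val a); first exact: startset_letter.
by rewrite mulgA uV i1M mulgA -yu.
Qed.

Definition transfer_seq b : seq H :=
  flatten [seq S e.1 e.2 | e <- fset_set (maximal_edges 1%g b)].

Lemma mem_transfer_seq b v :
  v \in transfer_seq b <-> exists2 e, maximal_edges 1%g b e & v \in S e.1 e.2.
Proof.
split=> [/flatten_mapP[e]|[e me ve]].
  rewrite in_fset_set; last exact: finite_maximal_edges.
  by rewrite inE => me ve; exists e.
apply/flatten_mapP; exists e => //.
by rewrite in_fset_set ?inE//; exact: finite_maximal_edges.
Qed.

Lemma source_cone_mull x y a g :
  source_cone (i2 x * y)%g a (i2 x * g)%g <-> source_cone y a g.
Proof.
split=> -[z az e]; exists z => //; last by rewrite e mulgA.
by move: e; rewrite -mulgA => /mulgI.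
Qed.

Lemma target_cone_mull x x' b g :
  target_cone (x * x')%g b (i2 x * g)%g <-> target_cone x' b g.
Proof. by rewrite /target_cone /= pM invgM -mulgA mulKg. Qed.

Lemma source_sub_mull x x' y a b :
  source_cone (i2 x * y)%g a `<=` target_cone (x * x')%g b <->
  source_cone y a `<=` target_cone x' b.
Proof.
split=> h g.
  by move=> yg; apply/(target_cone_mull x); apply: h; apply/source_cone_mull.
rewrite -[g](mulVKg (i2 x)) => /source_cone_mull /h.
by move/(target_cone_mull x).
Qed.

Lemma maximal_edges_mull x x' b y a :
  maximal_edges (x * x')%g b ((i2 x * y)%g, a) <-> maximal_edges x' b (y, a).
Proof.
split=> -[/= /source_sub_mull h n]; split=> //= c ca.
  by move=> /(source_sub_mull x); rewrite mulgA; exact: n.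
by rewrite -mulgA => /source_sub_mull; exact: n.
Qed.

(** Maximality is invariant under G2, so the maximal edges of any target cone are translates of
    those at x = 1. *)
Lemma transfer_orbit x b e v : maximal_edges x b e -> v \in S e.1 e.2 ->
  exists2 t, t \in transfer_seq b & v = rho x t.
Proof.
case: e => y a; rewrite -[y](mulVKg (i2 x)) -{1}[x]mulg1.
move=> /maximal_edges_mull me /= vS; exists (rho x^-1%g v); last by rewrite repKV.
apply/mem_transfer_seq; exists ((i2 x)^-1 * y, a)%g => //=.
by rewrite -i2V; apply: S_equiv; rewrite mulVKg in vS.
Qed.

Lemma finite_edges (n : nat) : finite_set [set e : G2 * letters A2 | wlen A2 e.1 = n /\ ext e.1 e.2].
Proof.
apply: sub_finite_set (finite_setX (finite_ball A2 n.+1) (@finite_finset _ [set: letters A2])).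
by move=> e [/= -> _]; split.
Qed.

Lemma transfer_family : cone_family rho transfer_seq.
Proof.
split.
- move=> a s /mem_transfer_seq[[y c] /= [/= me nme] sS].
  (* D collects the edges that follow a. Their cones cover the cone of a except for the vertex a,
     whose preimage under p is finite. *)
  pose D := [set e : G2 * letters A2 | e.1 = val a /\ (val a * val e.2)%g != 1%g].
  have DC e : D e -> target_cone e.1 e.2 `<=` target_cone 1%g a.
    move=> [-> ae] g; rewrite /target_cone /= invg1 mul1g => eg.
    by rewrite -[p g](mulVKg (val a)); exact: startset_mull eg.
  have Df : finite_set D.
    apply: sub_finite_set (finite_setX (finite_set1 (val a)) (@finite_finset _ [set: letters A2])).
    by move=> e [/= -> _].
  have h := @refine_edge D _ y c Df (finite_preim_p (finite_set1 (val a))) _ _ _ s sS.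
  apply: lspan_sub (h _ _ _) => {h} [w [e [e' [[ea ae] me' we']]]|g /me|e De h|e De h].
  + have [t tb ->] := transfer_orbit me' we'.
    by apply: sub_lspan; exists e.2, t; rewrite ea.
  + rewrite /target_cone /= invg1 mul1g => /startset_step[->|[b [ab bg]]]; first by left.
    by right; exists (val a, b).
  (* If a cone of D contained the complement of the source cone, the cone of a would contain the
     whole orbit of y. *)
  + have [z nz] := target_escape 1%g a y.
    have [cz|cz] := pselect (startset c z); apply: nz; first by apply: me; exists z.
    by apply: DC De _ _; exact: h.
  + by split=> //= d dc /= dS; apply: (nme d dc); apply: subset_trans dS (DC e De).
- move=> x a y b d s t /mem_transfer_seq[e [me _] se] /mem_transfer_seq[e' [me' _] te'].
  apply: S_orth (S_equiv x se) (S_equiv y te').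
  apply/seteqP; split=> // g [ge ge']; rewrite -[y]mulg1 -[x]mulg1 in d.
  have : (cone (x * 1)%g a `&` cone (y * 1)%g b) (p g); last by rewrite d.
  by split; [move/source_sub_mull: me => /(_ x)|move/source_sub_mull: me' => /(_ y)]; apply.
- move=> U U0 oU; have [v [Uv Sv]] := S_dense U0 oU; exists v; split=> //.
  apply: lspan_sub Sv => {Uv}v [y [a vS]].
  (* N is at least the length of the images of y and of the first vertex of its edge. Hence no cone
     of D contains the source cone or its complement. *)
  pose N := maxn (wlen A2 (p (y * i1 (val a))%g)) (wlen A2 (p (y * i1 1)%g)).
  pose D := [set e : G2 * letters A2 | wlen A2 e.1 = N /\ ext e.1 e.2].
  have DN e g : D e -> target_cone e.1 e.2 g -> (N < wlen A2 (p g))%N.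
    move=> [eN ext_e] eg; rewrite -[p g](mulVKg e.1) (wlen_cat ext_e eg) eN.
    rewrite -[ltnLHS]addn0 ltn_add2l.
    by case: eg => w; rewrite /wlen => ->.
  have Qf := finite_preim_p (finite_ball A2 N.+1).
  have h := @refine_edge D _ y a (finite_edges N) Qf _ _ _ v vS.
  apply: lspan_sub (h _ _ _) => {h} [w [e [e' [_ me' we']]]|g _|e De h|e De h].
  + have [t tb ->] := transfer_orbit me' we'.
    by apply: sub_lspan; exists e.1, e.2, t.
  + have [gN|gN] := ltnP (wlen A2 (p g)) N.+1; first by left.
    right; have [|x [b [xN bx sx]]] := @sphere_prefix_ex _ A2 N.+1 (p g); first exact: gN.
    have [ext_x lx] := endset_split bx.
    exists ((x * (val b)^-1)%g, b); last by rewrite /target_cone /= invgM invgK.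
    by split=> //=; apply/eqP; rewrite -eqSS -lx xN.
  + have := DN e _ De (h 1%g (fun h1 => startset_neq1 h1 erefl)).
    by rewrite ltnNge leq_maxr.
  + have := DN e _ De (h _ (ex_intro2 _ _ (val a) (startset_letter a) erefl)).
    by rewrite ltnNge leq_maxl.
Qed.

End Transfer.

(** * Bases of free groups and of their subgroups of finite index *)

Section ReducedWords.
Local Open Scope group_scope.
Variable G : groupType.
Implicit Types (S : set G) (w : seq G) (x g : G).

Lemma symm_closureV S g : symm_closure S g -> symm_closure S g^-1.
Proof.
case=> [Sg|[x Sx <-]]; first by right; exists g.
by left; rewrite invgK.
Qed.

Lemma reduced_product S w : (forall a, a \in w -> symm_closure S a) ->
  exists w', reduced_word S w' /\ (\prod_(a <- w') a)%g = (\prod_(a <- w) a)%g.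
Proof.
elim: w => [|c w ih] h; first by exists [::]; rewrite big_nil; split=> //; split.
have [|w' [[hw' sw'] e]] := ih; first by move=> a aw; apply: h; rewrite inE aw orbT.
have Sc : symm_closure S c by apply: h; exact: mem_head.
rewrite big_cons -e; case: w' hw' sw' {e} => [|d w'] hw' sw'.
  exists [:: c]; rewrite big_seq1 big_nil mulg1; split=> //; split=> // a.
  by rewrite inE => /eqP ->.
have [cd|cd] := eqVneq (c * d) 1.
  exists w'; rewrite big_cons mulgA cd mul1g; split=> //; split.
    by move=> a aw; apply: hw'; rewrite inE aw orbT.
  exact: path_sorted sw'.
exists [:: c, d & w']; rewrite big_cons; split=> //; split.
  by move=> a; rewrite inE => /predU1P[->//|]; exact: hw'.
by rewrite /= cd.
Qed.

Lemma symm_closure_word S T w : (forall a, S a -> exists w',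
    (forall b, b \in w' -> symm_closure T b) /\ (\prod_(b <- w') b)%g = a) ->
  (forall a, a \in w -> symm_closure S a) ->
  exists w', (forall b, b \in w' -> symm_closure T b) /\
    (\prod_(b <- w') b)%g = (\prod_(a <- w) a)%g.
Proof.
move=> ST; elim: w => [|c w ih] h; first by exists [::].
have [|w1 [h1 e1]] := ih; first by move=> a aw; apply: h; rewrite inE aw orbT.
have [w2 [h2 e2]] : exists w', (forall b, b \in w' -> symm_closure T b) /\
    (\prod_(b <- w') b)%g = c.
  have [/ST//|[d /ST[w' [h' e']] <-]] := h c (mem_head _ _).
  exists (rev (map (fun g => g^-1) w')); split.
    by move=> b; rewrite mem_rev => /mapP[b' /h' Tb' ->]; exact: symm_closureV.
  rewrite -e' {e' h'}; elim: w' => [|g w' ih']; first by rewrite !big_nil invg1.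
  by rewrite /= rev_cons -cats1 big_cat big_seq1 /= ih' big_cons invgM.
exists (w2 ++ w1); rewrite big_cat big_cons /= e1 e2; split=> // b.
by rewrite mem_cat => /orP[/h2|/h1].
Qed.

(** Let T be the part of S occurring in the words of the finitely many generators. Any s in S is a
    product of letters of T and their inverses; its reduced form is the one-letter word s, so s is
    in T. *)
Lemma finite_free_basis S : finitely_generated_group G -> free_basis S -> finite_set S.
Proof.
move=> [X genX] [SV Su].
have [f hf] := choice (fun x => Su x).
pose L := flatten [seq f x | x <- X].
pose T := S `&` [set s | s \in L \/ s^-1 \in L].
have Tf : finite_set T.
  apply: (@sub_finite_set _ _ ([set` L] `|` [set x^-1 | x in [set` L]])).
    by move=> s [_ [sL|sL]]; [left|right; exists s^-1; rewrite ?invgK].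
  by rewrite finite_setU; split; [|apply: finite_image]; exact: finite_seq.
suff ST : S `<=` T by exact: sub_finite_set ST Tf.
move=> s Ss; have [w [hw ws]] := genX s.
have [|w1 [h1 e1]] := symm_closure_word (T := T) _ hw.
  move=> x Xx; exists (f x); have [[[hx _] px] _] := hf x; split=> // b bx.
  have bL : b \in L by apply/flatten_mapP; exists x.
  have [Sb|[c Sc cb]] := hx b bx; first by left; split=> //; left.
  by right; exists c => //; split=> //; right; rewrite cb.
have [w2 [[h2 s2] e2]] := reduced_product h1.
have [w0 [_ w0u]] := Su s.
have Tsub a : symm_closure T a -> symm_closure S a.
  by case=> [[Sa _]|[c [Sc _] <-]]; [left|right; exists c].
have ew : w2 = [:: s].
  rewrite -(w0u w2); last by rewrite e2 e1; split=> //; split=> // a /h2 /Tsub.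
  apply: w0u; rewrite big_seq1; split=> //; split=> // a.
  by rewrite inE => /eqP ->; left.
have [//|[c [Sc _] cs]] : symm_closure T s by apply: h2; rewrite ew mem_head.
have : (S `&` [set x^-1 | x in S]) s by split=> //; exists c.
by rewrite SV.
Qed.

Lemma free_generators_exist : free_group G -> finitely_generated_group G ->
  ~ abelian_group G -> exists A : free_generators G, True.
Proof.
move=> [S Sfree] fg nab; have Sf := finite_free_basis fg Sfree.
have basis : free_basis [set` fset_set S] by rewrite fset_setK.
have n0 : fset_set S != fset0.
  apply/eqP => S0; apply: nab => x y.
  have one (z : G) : z = 1.
    have [_ /(_ z)[[|a w] [[[hw _] <-] _]]] := basis; first by rewrite big_nil.
    have := hw a (mem_head _ _); rewrite S0.
    by case=> [|[c]]; rewrite /= inE.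
  by rewrite [x]one [y]one.
by exists (FreeGenerators basis n0).
Qed.

End ReducedWords.

Lemma uniq_map_inj (T1 T2 : eqType) (f : T1 -> T2) (s : seq T1) :
  uniq (map f s) -> {in s &, injective f}.
Proof.
elim: s => //= a s ih /andP[na us] x y.
rewrite !inE => /predU1P[->|xs] /predU1P[->|ys] // e; last exact: ih.
- by rewrite e map_f in na.
- by rewrite -e map_f in na.
Qed.

(** * Schreier generators of a subgroup of finite index *)

Section Schreier.
Local Open Scope group_scope.
Variables (G : groupType) (A : free_generators G).
Variables (P : pred G) (K : subGroupType P).
Implicit Types (x y z t : G) (k h : K) (b c : letters A) (T : set G).

Let vM (x y : K) : val (x * y) = val x * val y := valM x y.
Let v1 : val (1 : K) = 1 := val1 K.
Let vV (x : K) : val x^-1 = (val x)^-1.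
Proof. by apply: (@mulgI _ (val x)); rewrite -vM !mulgV v1. Qed.

Definition prefix_closed T := forall x b, endset b x -> T x -> T (x * (val b)^-1).

Lemma left_coset_invP x y : left_coset K x^-1 = left_coset K y^-1 ->
  exists k, x = val k * y.
Proof.
move=> e; have : left_coset K x^-1 x^-1 by exists 1; rewrite // v1 mulg1.
by rewrite e => -[k _ yk]; exists k^-1; rewrite vV -[x]invgK -yk invgM invgK.
Qed.

Lemma left_coset_invM k y : left_coset K (val k * y)^-1 = left_coset K y^-1.
Proof. by rewrite invgM -vV left_cosetM. Qed.

(** Among the prefix-closed sets that contain 1 and meet each coset K x at most once, one of maximal
    size meets every coset; the index bounds the size. *)
Lemma schreier_transversal : finite_index K -> exists T : set G,
  [/\ finite_set T, T 1, prefix_closed T,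
    forall x, exists k, T ((val k)^-1 * x) &
    forall x k, T x -> T (val k * x) -> k = 1].
Proof.
(* Inversion turns the right coset K x into a left coset, for which the index is defined. *)
move=> fin; pose c x := left_coset K x^-1.
pose good (s : seq G) := [/\ uniq (map c s), 1 \in s & prefix_closed [set` s]].
have ltc x : c x \in fset_set (left_cosets K).
  by rewrite in_fset_set// inE; exists x^-1.
have size_good s : good s -> (size s <= #|` fset_set (left_cosets K)|)%N.
  move=> [us _ _]; rewrite -(size_map c); apply: uniq_leq_size us _.
  by move=> _ /mapP[x _ ->].
have ex : exists n, `[< exists s, good s /\ size s = n >].
  exists 1%N; apply/asboolP; exists [:: 1]; split=> //; split; rewrite ?mem_head//.
  move=> x b bx /=; rewrite inE => /eqP x1; move: bx => /endset_gt0.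
  by rewrite x1 wlen1.
have bnd n : `[< exists s, good s /\ size s = n >] ->
    (n <= #|` fset_set (left_cosets K)|)%N.
  by move=> /asboolP[s [gs <-]]; exact: size_good.
case: (ex_maxnP ex bnd) => n /asboolP[s [[us s1 ps] sn]] nmax.
(* Induction on x: if t represents K x, then t b represents K x b. Either t b is a prefix of t, or
   it could be added to s, against maximality. *)
have cover x : c x \in map c s.
  elim/(@ext_ind _ A): x => [|x b xb /mapP[t ts /left_coset_invP[k xkt]]].
    exact: map_f.
  have -> : c (x * val b) = c (t * val b) by rewrite xkt -mulgA /c left_coset_invM.
  apply/negPn/negP => nctb.
  have [tb|ntb] := pselect (ext t b).
    suff : good (t * val b :: s).
      move=> gs; have : `[< exists s', good s' /\ size s' = n.+1 >].
        by apply/asboolP; exists (t * val b :: s); rewrite /= sn.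
      by move=> /nmax; rewrite ltnn.
    split; [by rewrite /= nctb|by rewrite inE s1 orbT|].
    move=> z d dz; rewrite /= !inE => /predU1P[zt|zs].
      rewrite zt in dz *; rewrite (endset_inj dz (endset_ext tb)) mulgK ts.
      by rewrite orbT.
    by rewrite ps ?orbT.
  have t1 : (0 < wlen A t)%N.
    by rewrite lt0n; apply/eqP => /wlen_eq0 t1; apply: ntb; rewrite t1; exact: ext1.
  have [a ta] := endset_ex t1.
  have /eqP : (val a * val b == 1).
    by apply/negPn/negP => h; apply: ntb; apply/(extP _ ta).
  move/eqP; rewrite letter_mul_eq1 => /eqP ba.
  have := ps t a ta ts; rewrite -[(val a)^-1]/(val (letter_inv a)) -ba => /(map_f c).
  by apply/negP.
exists [set` s]; split=> //.
- move=> x; have /mapP[t ts e] := cover x.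
  by have [k ->] := left_coset_invP e; exists k; rewrite /= mulKg.
- move=> x k xs kxs; have e : c (val k * x) = c x by exact: left_coset_invM.
  have := uniq_map_inj us kxs xs e => /(canRL (mulgK x)); rewrite mulgV => k1.
  by apply/val_inj; rewrite k1 v1.
Qed.

Section Transversal.
Variable T : set G.
Hypothesis T_finite : finite_set T.
Hypothesis T1 : T 1.
Hypothesis T_prefix : prefix_closed T.
Hypothesis T_cover : forall x, exists k, T ((val k)^-1 * x).
Hypothesis T_inj : forall x k, T x -> T (val k * x) -> k = 1.

(** The factor k in the decomposition x = k t with t in T. *)
Definition coset_part x : K := projT1 (cid (T_cover x)).

Lemma coset_partP x : T ((val (coset_part x))^-1 * x).
Proof. exact: projT2 (cid (T_cover x)). Qed.

Lemma coset_part_uniq x k : T ((val k)^-1 * x) -> coset_part x = k.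
Proof.
move=> Tk; have := @T_inj _ (k^-1 * coset_part x) (coset_partP x).
rewrite vM vV -mulgA mulVKg => /(_ Tk) e.
by rewrite -[LHS](mulVKg k) e mulg1.
Qed.

Lemma coset_partM k x : coset_part (val k * x) = k * coset_part x.
Proof.
apply: coset_part_uniq; rewrite vM invgM -mulgA mulKg.
exact: coset_partP.
Qed.

Lemma coset_part_eq1 x : coset_part x = 1 <-> T x.
Proof.
split=> [e|Tx]; first by have := coset_partP x; rewrite e v1 invg1 mul1g.
by apply: coset_part_uniq; rewrite v1 invg1 mul1g.
Qed.

(** T is a finite subtree whose K-translates tile G. An exit edge leads from T to another tile,
    which [coset_part] of its endpoint names. *)
Definition exit_edge t b := T t /\ ~ T (t * val b).

Lemma exit_ext t b : exit_edge t b -> ext t b.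
Proof.
move=> [Tt nTtb]; have [->|t1] := eqVneq t 1; first exact: ext1.
have [|a ta] := @endset_ex _ A t.
  by rewrite lt0n; apply: contraNneq t1 => /wlen_eq0 ->.
apply/(extP _ ta); rewrite letter_mul_eq1; apply/eqP => ba.
by apply: nTtb; rewrite ba; exact: T_prefix ta Tt.
Qed.

Lemma exit_cone t b z : exit_edge t b -> startset b (t^-1 * z) -> ~ T z.
Proof.
move=> e bz; rewrite -[z](mulVKg t); move: (t^-1 * z) bz.
apply: startset_ind => [|{}z c bz zc ih Tzc]; first by case: e.
apply: ih; have := @T_prefix (t * z * val c) c; rewrite mulgK; apply.
  exact/endset_ext/(ext_startset (exit_ext e) bz).
by rewrite -mulgA.
Qed.

Lemma cone_ext t b x c : ext t b -> ext x c -> startset b (t^-1 * (x * val c)) ->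
  (t = x /\ b = c) \/ startset b (t^-1 * x).
Proof.
move=> tb xc bw; have := endset_ext xc.
have [|d wd] := @endset_ex _ A (t^-1 * (x * val c)).
  by case: bw => w; rewrite /wlen => ->.
have := endset_cat tb bw wd; rewrite mulVKg => xcd xcc.
rewrite (endset_inj xcd xcc) {xcd xcc} in wd.
have [+ _] := endset_split wd; rewrite -!mulgA mulgV mulg1 => ext_w.
have [tx|/(@startset_ex _ A)[a ax]] := eqVneq (t^-1 * x) 1.
  left; have e : t = x by rewrite -[x](mulVKg t) tx mulg1.
  split=> //; apply: startset_inj bw _; rewrite mulgA tx mul1g.
  exact: startset_letter.
right; have := startset_ext ax ext_w; rewrite -mulgA => axc.
by rewrite (startset_inj bw axc).
Qed.

(** Follow z from 1 to the first vertex in either cone. It ends one of the edges; were the cones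
    distinct, the other would already contain, or later be entered from, a vertex that lies both in
    T and beyond an exit edge. *)
Lemma exit_disjoint t b t' b' z : exit_edge t b -> exit_edge t' b' ->
  startset b (t^-1 * z) -> startset b' (t'^-1 * z) -> t = t' /\ b = b'.
Proof.
move=> e e'; elim/(@ext_ind _ A): z => [h|x c xc ih].
  by have := exit_cone e h.
move=> /(cone_ext (exit_ext e) xc)[[tx bc]|h] /(cone_ext (exit_ext e') xc)[[tx' bc']|h'].
- by rewrite tx bc.
- by have := exit_cone e' h'; rewrite -tx; case: e.
- by have := exit_cone e h; rewrite -tx'; case: e'.
- exact: ih.
Qed.

(** This is the same edge reversed and seen from the neighbouring tile, after translation of that
    tile to T. *)
Lemma exit_inv t b : exit_edge t b ->
  exit_edge ((val (coset_part (t * val b)))^-1 * (t * val b)) (letter_inv b) /\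
  coset_part ((val (coset_part (t * val b)))^-1 * (t * val b) * val (letter_inv b)) =
    (coset_part (t * val b))^-1.
Proof.
move=> [Tt nTtb]; set k := coset_part _.
have e : coset_part ((val k)^-1 * (t * val b) * val (letter_inv b)) = k^-1.
  rewrite -mulgA mulgK -vV coset_partM.
  by have /coset_part_eq1 -> := Tt; rewrite mulg1.
split=> //; split; first exact: coset_partP.
move=> /coset_part_eq1; rewrite e => k1; apply: nTtb; apply/coset_part_eq1.
by rewrite -/k -[k]invgK k1 invg1.
Qed.

Lemma exit_cone_compl t b z :
  startset b (t^-1 * z) <->
  ~ startset (letter_inv b) (((val (coset_part (t * val b)))^-1 * (t * val b))^-1 *
      ((val (coset_part (t * val b)))^-1 * z)).
Proof.
set k := coset_part _; have -> : ((val k)^-1 * (t * val b))^-1 * ((val k)^-1 * z) =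
    (val b)^-1 * (t^-1 * z).
  by rewrite !invgM invgK -!mulgA mulVKg.
split=> [h /startset_compl//|h]; apply: contrapT => n; apply: h.
exact/startset_compl.
Qed.

(* If two different exit edges had the same coset part [k], their cones would be
   disjoint, so [k] would lie outside one of them; the translate by [k^-1] of that
   complement is the cone of an exit edge, and it would contain 1. *)
Lemma exit_inj t b t' b' : exit_edge t b -> exit_edge t' b' ->
  coset_part (t * val b) = coset_part (t' * val b') -> t = t' /\ b = b'.
Proof.
move=> e e' ek; pose z : G := val (coset_part (t * val b)).
have in_cone s d : exit_edge s d -> coset_part (s * val d) = coset_part (t * val b) ->
    startset d (s^-1 * z).
  move=> es ks; apply/exit_cone_compl; rewrite ks /z mulVg => h.
  have [+ _] := exit_inv es; rewrite ks => /exit_cone /(_ h); exact.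
by apply: exit_disjoint e e' (in_cone _ _ e erefl) (in_cone _ _ e' (esym ek)).
Qed.

(** Reversing an exit edge inverts its letter and its coset part. Keeping the letters of the basis
    selects one element from each pair k, k^-1. *)
Definition schreier_gens : set K :=
  [set k | exists t b, [/\ exit_edge t b, val b \in gens A & coset_part (t * val b) = k]].

Lemma symm_schreier k : symm_closure schreier_gens k <->
  exists t b, exit_edge t b /\ coset_part (t * val b) = k.
Proof.
split=> [[[t [b [e _ <-]]]|[_ [t [b [e _ <-]]] <-]]|[t [b [e <-]]]].
- by exists t, b.
- have [e' ek] := exit_inv e; by do 2!eexists; split; first exact: e'.
- have /lettersP[bA|[c cA cb]] := valP b; first by left; exists t, b.
  right; have [e' ek] := exit_inv e.
  exists (coset_part (t * val b))^-1; last by rewrite invgK.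
  by do 2!eexists; split; [exact: e'| |exact: ek]; rewrite /= -cb invgK.
Qed.

Lemma schreier_finite : finite_set schreier_gens.
Proof.
have := finite_image (fun e => coset_part (e.1 * val e.2))
  (finite_setX T_finite (@finite_finset _ [set: letters A])).
by apply: sub_finite_set => k [t [b [[Tt _] _ <-]]]; exists (t, b).
Qed.

Lemma schreier_disjoint : schreier_gens `&` [set k^-1 | k in schreier_gens] = set0.
Proof.
apply/seteqP; split=> // k [[t [b [e bA ek]]] [_ [t' [b' [e' b'A <-]]] ek']].
have [e'' ek''] := exit_inv e'.
have [_ bb'] := exit_inj e e'' (etrans ek (etrans (esym ek') (esym ek''))).
have : ([set` gens A] `&` [set x^-1 | x in [set` gens A]]) (val b).
  by split=> //; exists (val b') => //; rewrite bb'.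
by have [-> _] := gens_free A.
Qed.

Lemma schreier_word k : exists w, reduced_word schreier_gens w /\
  (\prod_(a <- w) a)%g = k.
Proof.
(* The claim is proved for all x in G, so that x can be read letter by letter; each passage to
   another tile contributes one generator. *)
suff h x : exists w : seq K, (forall a, a \in w -> symm_closure schreier_gens a) /\
    (\prod_(a <- w) a)%g = coset_part x.
  have [w [hw e]] := h (val k * 1); have [w' [rw' e']] := reduced_product hw.
  exists w'; split=> //; rewrite e' e coset_partM.
  by have /coset_part_eq1 -> := T1; rewrite mulg1.
elim/(@ext_ind _ A): x => [|x b _ [w [hw e]]].
  by exists [::]; rewrite big_nil; have /coset_part_eq1 -> := T1.
pose t := (val (coset_part x))^-1 * x.
have -> : x * val b = val (coset_part x) * (t * val b) by rewrite /t -mulgA mulVKg.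
rewrite coset_partM; have [/coset_part_eq1 ->|nT] := pselect (T (t * val b)).
  by exists w; rewrite mulg1.
exists (rcons w (coset_part (t * val b))); split.
  move=> a; rewrite mem_rcons inE => /predU1P[->|]; last exact: hw.
  by apply/symm_schreier; exists t, b; split=> //; split=> //; exact: coset_partP.
by rewrite -cats1 big_cat big_seq1 /= e.
Qed.

(** By induction the product of w lies in the cone of its first letter. As the word is reduced, that
    cone is disjoint from the one of [k^-1], and k maps the complement of the latter onto the cone
    of k. *)
Lemma schreier_pingpong k w t b : reduced_word schreier_gens (k :: w) ->
  exit_edge t b -> coset_part (t * val b) = k ->
  startset b (t^-1 * val (\prod_(a <- k :: w) a)%g).
Proof.
elim: w k t b => [|k' w ih] k t b [hw sw] e ek; apply/exit_cone_compl; rewrite ek.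
  rewrite big_seq1 mulVg; have [+ _] := exit_inv e; rewrite ek.
  by move=> /exit_cone h /h; apply.
have /symm_schreier[t' [b' [e' ek']]] : symm_closure schreier_gens k'.
  by apply: hw; rewrite inE mem_head orbT.
rewrite big_cons vM mulKg => h.
have rw' : reduced_word schreier_gens (k' :: w).
  split; first by move=> a aw; apply: hw; rewrite inE aw orbT.
  exact: path_sorted sw.
have h' := ih _ _ _ rw' e' ek'; have [e2 ek2] := exit_inv e; rewrite ek in e2 ek2.
have [tt' bb'] := exit_disjoint e2 e' h h'.
move: sw => /= /andP[/eqP kk' _]; apply: kk'.
by rewrite -ek' -tt' -bb' ek2 mulgV.
Qed.

(** By ping-pong the cone containing a product determines its first letter, and a nonempty reduced
    product differs from 1, which lies in T and so in no exit cone. *)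
Lemma schreier_free : free_basis schreier_gens.
Proof.
split; first exact: schreier_disjoint.
move=> k; have [w [rw ew]] := schreier_word k; exists w; split=> // w2 [rw2].
rewrite -ew => {ew k}; elim: w w2 rw rw2 => [|k w ih] [|k2 w2] rw rw2 //.
- rewrite big_nil => e2.
  have /symm_schreier[t [b [e ek]]] := rw2.1 _ (mem_head _ _).
  have := schreier_pingpong rw2 e ek; rewrite e2 v1 => /(exit_cone e).
  by move/(_ T1).
- rewrite big_nil => /esym e2.
  have /symm_schreier[t [b [e ek]]] := rw.1 _ (mem_head _ _).
  have := schreier_pingpong rw e ek; rewrite e2 v1 => /(exit_cone e).
  by move/(_ T1).
have /symm_schreier[t [b [e ek]]] := rw.1 _ (mem_head _ _).
have /symm_schreier[t2 [b2 [e2 ek2]]] := rw2.1 _ (mem_head _ _).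
have h := schreier_pingpong rw e ek; have h2 := schreier_pingpong rw2 e2 ek2.
move=> ee; rewrite ee in h2; have [tt bb] := exit_disjoint e e2 h h2.
have kk : k = k2 by rewrite -ek -ek2 tt bb.
have tailr (a : K) u : reduced_word schreier_gens (a :: u) -> reduced_word schreier_gens u.
  move=> [hu su]; split; first by move=> d du; apply: hu; rewrite inE du orbT.
  exact: path_sorted su.
rewrite -kk !big_cons in ee *; congr (_ :: _).
by apply: ih; [exact: tailr rw|exact: tailr rw2|exact: mulgI ee].
Qed.

(** Without exit edges T would be all of G, although T is finite and word lengths are unbounded. *)
Lemma schreier_neq0 : schreier_gens !=set0.
Proof.
apply: contrapT => n0.
have noexit t b : ~ exit_edge t b.
  move=> e; have : symm_closure schreier_gens (coset_part (t * val b)).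
    by apply/symm_schreier; exists t, b.
  by case=> [S|[k S _]]; apply: n0; eexists; exact: S.
have TT x : T x.
  elim/(@ext_ind _ A): x => // x b _ Tx; apply: contrapT => nT.
  exact: (noexit x b).
have [N hN] := finite_eventually A T_finite.
have [a _] := a0_subproof A; have [x _ xN] := wlen_unbounded a N.
by apply: (hN x); rewrite ?xN.
Qed.

End Transversal.

Lemma schreier : finite_index K -> exists (B : free_generators K) (p : G -> K),
  (forall k x, p (val k * x) = k * p x) /\ finite_set [set x | p x = 1].
Proof.
move=> /schreier_transversal[T [Tf T1 Tp Tc Ti]].
have Sf : finite_set (schreier_gens Tc) by exact: schreier_finite.
have basis : free_basis [set` fset_set (schreier_gens Tc)].
  by rewrite fset_setK//; exact: schreier_free.
have n0 : fset_set (schreier_gens Tc) != fset0.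
  have [k Sk] : schreier_gens Tc !=set0 by exact: schreier_neq0.
  have : k \in fset_set (schreier_gens Tc) by rewrite in_fset_set ?inE.
  by apply: contraTneq => ->.
exists (FreeGenerators basis n0), (coset_part Tc); split; first exact: coset_partM.
by apply: sub_finite_set Tf => x /= h; apply/(coset_part_eq1 Tc).
Qed.

End Schreier.

(** * Restriction and induction *)

Lemma denseP_norm (R : realType) (H : hilbertType R) (S : set H) :
  dense S <-> forall v (e : R[i]), 0 < e -> exists2 m, S m & `|v - m| < e.
Proof.
split=> [dS v e e0|h U [v Uv] oU].
  have [] := dS (ball v e).
  - by exists v; exact: ballxx.
  - exact: ball_open.
  by move=> m [+ Sm]; rewrite -ball_normE /= => vm; exists m.
have : nbhs v U by exact: open_nbhs_nbhs.
move=> /nbhs_ballP[e /= e0 eU]; have [m Sm vm] := h v e e0.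
by exists m; split=> //; apply: eU; rewrite -ball_normE.
Qed.

Lemma normr_dotp (R : realType) (H K : hilbertType R) (u : H) (v : K) :
  dotp u u = dotp v v -> `|u| = `|v|.
Proof.
move=> uv; apply/eqP; rewrite -(@eqrXn2 _ 2)//.
by rewrite !dotp_norm uv.
Qed.

Lemma Mult_restricted (R : realType) (G : groupType) (P : pred G) (K : subGroupType P)
    (fin_K : finite_index K) (H : hilbertType R) (rho : unitary_rep G H) :
  Mult rho -> Mult (restricted_rep K rho).
Proof.
move=> /Mult_cone_family[A [S [Ssplit Sorth Sdense]]].
have [B [p [pM pfin]]] := schreier A fin_K.
pose S' (y : G) a := [seq rho y s | s <- S a].
have vM (x y : K) : val (x * y)%g = (val x * val y)%g by exact: valM.
have v1 : val (1 : K)%g = 1%g by exact: val1.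
apply: (@cone_family_Mult _ _ _ _ B).
apply: (@transfer_family R G G K A B id val p _ vM _ pM pfin [set 1%g] _ _ _ H
  (restricted_rep K rho) S') => //.
- by move=> g; exists 1%g => //; exists g; rewrite mul1g.
(* The witness moves y to the element [(p 1)^-1] of K, which p sends to 1, a point in no cone. *)
- move=> y b; exists (y^-1 * val (p 1%g)^-1%g)%g; rewrite mulVKg.
  by rewrite -[val _]mulg1 pM mulVg => /startset_neq1.
- move=> y a _ /mapP[s /Ssplit sS ->].
  apply: lspan_linear sS => _ [b [t [ab tb ->]]]; apply: sub_lspan.
  by exists b; split=> //; rewrite -repM; exact: map_f.
- move=> y a y' a' d _ _ /mapP[s sa ->] /mapP[t ta ->].
  apply: Sorth sa ta; apply/seteqP; split=> // z [za za'].
  suff : (source_cone id y a `&` source_cone id y' a') z by rewrite d.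
  by split; eexists; [exact: za|rewrite mulVKg|exact: za'|rewrite mulVKg].
- move=> U U0 oU; have [v [Uv Sv]] := Sdense U U0 oU; exists v; split=> //.
  apply: lspanS Sv => _ [x [b [t [tb ->]]]].
  by exists x, b; exact: map_f.
- move=> x y a _ /mapP[s sa ->]; rewrite /= /restriction_map -repM.
  exact: map_f.
Qed.

(** * Induced vectors supported on a single coset *)

Section Induction.
Variables (R : realType) (G : groupType) (P : pred G) (K : subGroupType P).
Variables (H : hilbertType R) (rho : unitary_rep K H) (fin : finite_index K).
Implicit Types (x y g : G) (h k : K) (s t : H).

Let vM (x y : K) : val (x * y)%g = (val x * val y)%g := valM x y.
Let v1 : val (1 : K)%g = 1%g := val1 K.
Let vV (x : K) : val x^-1%g = (val x)^-1%g.
Proof. by apply: (@mulgI _ (val x)); rewrite -vM !mulgV v1. Qed.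

(** The support is the coset y K and the value at y is s; equivariance then forces the value at g to
    be the image of s under g^-1 y, whose membership in K is tested by [insub]. *)
Definition dirac_fun y s g : H :=
  if insub (g^-1 * y)%g is Some h then rho (h : K) s else 0.

Lemma dirac_fun_in y s g h : y = (g * val h)%g -> dirac_fun y s g = rho h s.
Proof. by move=> ->; rewrite /dirac_fun mulKg valK. Qed.

Lemma dirac_fun_out y s g : ~ (exists h : K, y = (g * val h)%g) -> dirac_fun y s g = 0.
Proof.
rewrite /dirac_fun => ny; case: insubP => // h _ e; case: ny.
by exists h; rewrite e mulVKg.
Qed.

Lemma dirac_fun_equivariant y s : dirac_fun y s \in ind_pred rho.
Proof.
apply/asboolP => k g; have [[h yh]|ny] := pselect (exists h : K, y = (g * val h)%g).
  rewrite (dirac_fun_in _ yh) -repM; apply/esym/dirac_fun_in.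
  by rewrite vM mulgA mulgVK.
rewrite !dirac_fun_out ?linear0// => -[h yh]; apply: ny.
by exists (k^-1 * h)%g; rewrite vM vV mulgA.
Qed.

Definition dirac y s : ind_space rho fin := IndSpace fin (dirac_fun_equivariant y s).

Lemma dirac_linear y : linear (dirac y).
Proof.
move=> c s t; apply/val_inj/funext => g /=.
rewrite -[RHS]/(c *: dirac_fun y s g + dirac_fun y t g).
have [[h yh]|ny] := pselect (exists h : K, y = (g * val h)%g).
  by rewrite !(dirac_fun_in _ yh) linearP.
by rewrite !dirac_fun_out// scaler0 addr0.
Qed.
HB.instance Definition _ y := GRing.isLinear.Build R[i] H (ind_space rho fin) *:%R
  (dirac y) (dirac_linear y).

Lemma dirac_rep y h s : dirac y (rho h s) = dirac (y * val h)%g s.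
Proof.
apply/val_inj/funext => g /=.
have [[k yk]|ny] := pselect (exists k : K, y = (g * val k)%g).
  rewrite (dirac_fun_in _ yk) (@dirac_fun_in _ _ _ (k * h)%g) ?repM//.
  by rewrite yk vM mulgA.
rewrite !dirac_fun_out// => -[k yk]; apply: ny; exists (k * h^-1)%g.
by rewrite vM vV mulgA -yk mulgK.
Qed.

Lemma induced_dirac x y s : induced_rep rho fin x (dirac y s) = dirac (x * y)%g s.
Proof.
apply/val_inj/funext => g /=; rewrite /dirac_fun; congr (if insub _ is Some _ then _ else _).
by rewrite invgM invgK mulgA.
Qed.

Lemma dotp_dirac y s (f : ind_space rho fin) : dotp (dirac y s) f = dotp s (f y).
Proof.
rewrite [LHS]ind_dotpE.
have yr : left_coset K y \in fset_set (left_cosets K).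
  by rewrite in_fset_set// inE; exists y.
rewrite (big_fsetD1 _ yr) /= (ind_dotp_coset (dirac y s) f) /=.
rewrite (@dirac_fun_in _ _ _ 1%g) ?v1 ?mulg1// rep1.
rewrite big_seq big1 ?addr0// => c; rewrite !inE => /andP[cy].
rewrite in_fset_set// inE => cK; rewrite dirac_fun_out ?linear0l// => -[h yh].
by move/eqP: cy; apply; rewrite yh left_cosetM left_coset_rep.
Qed.

Lemma dirac_norm y s : `|dirac y s| = `|s|.
Proof.
apply: normr_dotp; rewrite dotp_dirac /=.
by rewrite (@dirac_fun_in _ _ _ 1%g) ?v1 ?mulg1// rep1.
Qed.

Lemma dirac_sum (f : ind_space rho fin) :
  f = \sum_(c <- fset_set (left_cosets K)) dirac (coset_rep c) (f (coset_rep c)).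
Proof.
apply/val_inj/funext => g /=.
rewrite (big_morph (fun f' : ind_space rho fin => f' g)
  (fun f1 f2 => ind_addE f1 f2 g) (erefl : (0 : ind_space rho fin) g = 0)).
have gr : left_coset K g \in fset_set (left_cosets K).
  by rewrite in_fset_set// inE; exists g.
rewrite (big_fsetD1 _ gr) /= big_seq big1 ?addr0.
  have [h gh] := coset_repP K g.
  rewrite (@dirac_fun_in _ _ _ h^-1%g); last by rewrite {2}gh vV mulgK.
  by rewrite {1}gh ind_coset.
move=> c; rewrite !inE => /andP[cg]; rewrite in_fset_set// inE => cK.
apply: dirac_fun_out => -[h ch]; move/eqP: cg; apply.
by rewrite -(left_coset_rep cK) ch left_cosetM.
Qed.

(** A vector of the induced space is a finite sum of vectors supported on single cosets, and each
    [dirac y] is isometric, so approximation in H suffices. *)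
Lemma dirac_dense (D : set H) (E : set (ind_space rho fin)) : dense (lspan D) ->
  (forall y s, D s -> E (dirac y s)) -> dense (lspan E).
Proof.
move=> /denseP_norm dD DE; apply/denseP_norm.
have dirac_approx y s e : 0 < e -> exists2 m, lspan E m & `|dirac y s - m| < e.
  move=> /(dD s e)[m Dm sm]; exists (dirac y m); last by rewrite -linearB dirac_norm.
  by apply: (lspan_linear (L := dirac y)) Dm => t /(DE y); exact: sub_lspan.
move=> f; rewrite [f]dirac_sum.
elim/big_ind: _ => [e e0|f1 f2 h1 h2 e e0|c _ e].
- by exists 0; [case: (lspan_subspace E)|rewrite subrr normr0].
- have e20 : 0 < e / 2%:R by rewrite divr_gt0// ltr0n.
  have [m1 E1 l1] := h1 _ e20; have [m2 E2 l2] := h2 _ e20.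
  exists (m1 + m2); first exact: lspanD.
  rewrite opprD addrACA (le_lt_trans (ler_normD _ _))//.
  by rewrite [ltRHS](splitr e) ltrD.
- exact: dirac_approx.
Qed.

End Induction.

Lemma Mult_induced (R : realType) (G : groupType) (B : free_generators G)
    (P : pred G) (K : subGroupType P)
    (fin_K : finite_index K) (H : hilbertType R) (rho : unitary_rep K H) :
  Mult rho -> Mult (induced_rep rho fin_K).
Proof.
move=> /Mult_cone_family[A [S [Ssplit Sorth Sdense]]].
pose S' (y : G) a := [seq dirac rho fin_K y s | s <- S a].
have vM (x y : K) : val (x * y)%g = (val x * val y)%g by exact: valM.
have v1 : val (1 : K)%g = 1%g by exact: val1.
apply: (@cone_family_Mult _ _ _ _ B).
apply: (@transfer_family R G K G A B val id id vM _ val_inj _ _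
  [set coset_rep c | c in left_cosets K] _ _ _ _ (induced_rep rho fin_K) S') => //.
- exact: finite_set1.
- exact: finite_image.
- move=> g; exists (coset_rep (left_coset K g)); last exact: coset_repP.
  by exists (left_coset K g) => //; exists g.
- move=> y b.
  (* The coset [y K] meets the ball of radius [N] around every [x]; take [x] far
     away in the cone of [b^-1]. *)
  have [N hN] := finite_wlen_bound B (finite_image (@coset_rep _ ) fin_K).
  have [x bx xN] := wlen_unbounded (letter_inv b) N.
  have [h xh] := coset_repP K (x^-1 * y)%g.
  have rN := hN _ (ex_intro2 _ _ (left_coset K (x^-1 * y)%g)
    (ex_intro2 _ _ (x^-1 * y)%g I erefl) erefl).
  have yr : (y * val h^-1)%g = (x * coset_rep (left_coset K (x^-1 * y)%g))%g.
    apply: (@mulgI _ x^-1%g); rewrite mulKg mulgA xh -mulgA -vM mulgV v1 mulg1.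
    by rewrite -xh.
  exists h^-1%g; rewrite yr => by_.
  have := startset_inj by_ (startset_mulr _ bx); rewrite xN ltnS => /(_ rN) e.
  by have := letter_inv_neq b; rewrite -e eqxx.
- move=> y a _ /mapP[s /Ssplit sS ->].
  apply: (lspan_linear (L := dirac rho fin_K y)) sS => _ [b [t [ab tb ->]]]; apply: sub_lspan.
  by exists b; split=> //; rewrite /= dirac_rep; exact: map_f.
- move=> y a y' a' d _ _ /mapP[s sa ->] /mapP[t ta ->].
  (* Vectors on different cosets have disjoint supports. On one coset the product becomes a product
     in H, where the source cones are compared after translation by y^-1. *)
  rewrite dotp_dirac /=; have [[h yh]|ny] := pselect (exists h : K, y' = (y * val h)%g).
    rewrite (dirac_fun_in _ _ yh) -[s](rep1 rho).
    apply: Sorth sa ta; apply/seteqP; split=> // z [].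
    rewrite /cone /= invg1 mul1g => za za'.
    suff : (source_cone val y a `&` source_cone val y' a') (y * val z)%g by rewrite d.
    split; first by exists z.
    by exists (h^-1 * z)%g => //; rewrite yh -mulgA -vM mulVKg.
  by rewrite dirac_fun_out ?linear0r.
- apply: dirac_dense Sdense _ => y _ [x [b [t [tb ->]]]].
  by exists (y * val x)%g, b; rewrite dirac_rep; exact: map_f.
- move=> x y a _ /mapP[s sa ->]; rewrite induced_dirac.
  exact: map_f.
Qed.

Theorem theorem3 (R : realType) (G : groupType)
    (free_G : free_group G) (fg_G : finitely_generated_group G)
    (nonabelian_G : ~ abelian_group G)
    (P : pred G) (K : subGroupType P) (fin_K : finite_index K) :
  (forall (H : hilbertType R) (rho : unitary_rep G H),
     Mult rho -> Mult (restricted_rep K rho)) /\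
  (forall (H : hilbertType R) (rho : unitary_rep K H),
     Mult rho -> Mult (induced_rep rho fin_K)).
Proof.
split=> H rho; first exact: Mult_restricted.
(* Membership of [rho] provides a basis of K only; the tree of G needs a finite basis of G. *)
have [B _] := free_generators_exist free_G fg_G nonabelian_G.
exact: (Mult_induced B).
Qed.
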